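(* (i) There is an absolute positive constant $C$ so that for all $T>0$ and $0<r'<r$, $$\int_{B_{r'}}u^2(T,x)\,dx\le\left(\frac1T+\frac{Cn}{(r-r')^2}\right)\int_0^T\int_{B_r}u^2(t,x)\,dx\,dt,$$ whenever $u$ solves the heat equation. (ii) Given $T>0$ and $r'>r>0$, there is no constant $C=C(T,r',r,n)$ so that $$\int_{B_{r'}}u^2(T,x)\,dx\le C\int_0^T\int_{B_r}u^2(t,x)\,dx\,dt$$ for every solution $u$ of the heat equation.
   Context: The heat equation is $\partial_t u-\Delta u=0$ in $(0,\infty)\times\mathbb{R}^n$, $u(0,\cdot)\in L^2(\mathbb{R}^n)$; its solution is $u(t,\cdot)=e^{t\Delta}u(0,\cdot)$, where $\{e^{t\Delta}\}_{t\ge0}$ is the heat semigroup (convolution with $(4\pi t)^{-n/2}e^{-|x|^2/(4t)}$ for $t>0$). Solutions are real-valued. $B_r$ is the open ball in $\mathbb{R}^n$ centered at $0$ of radius $r$. An absolute constant is one independent of all parameters, including $n$. *)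

(* Defs.v *)
From HB Require Import structures.
From mathcomp Require Import all_boot all_order all_algebra.
From mathcomp Require Import all_classical all_reals all_analysis.

Set Implicit Arguments.
Unset Strict Implicit.
Unset Printing Implicit Defensive.

Import Order.TTheory GRing.Theory Num.Theory.
Import numFieldNormedType.Exports.

Local Open Scope classical_set_scope.
Local Open Scope ring_scope.

(* R^n is n.-tuple R, whose library sigma-algebra is generated by the
   coordinate projections, i.e. the Borel sigma-algebra of R^n. *)
Definition euclid (R : realType) (n : nat) := n.-tuple (measurableTypeR R).

Section LebesgueMeasure.
Context (R : realType).

Definition euclid_cons n (z : measurableTypeR R * euclid R n) : euclid R n.+1 :=
  [tuple of z.1 :: z.2].

Lemma measurable_euclid_cons n : measurable_fun setT (@euclid_cons n).
Proof. exact: measurable_cons. Qed.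

HB.instance Definition _ n := isMeasurableFun.Build _ _ _ _
  (@euclid_cons n) (@measurable_euclid_cons n).

Section Step.
Context (n : nat) (mu : {sigma_finite_measure set (euclid R n) -> \bar R}).

Definition leb_step : set (euclid R n.+1) -> \bar R :=
  pushforward (lebesgue_measure \x mu)%E (@euclid_cons n).

Let leb_step0 : leb_step set0 = 0%E.
Proof. exact: measure0. Qed.

Let leb_step_ge0 A : (0 <= leb_step A)%E.
Proof. exact: measure_ge0. Qed.

Let leb_step_sigma_additive : semi_sigma_additive leb_step.
Proof. exact: measure_semi_sigma_additive. Qed.

HB.instance Definition _ := isMeasure.Build _ _ _ leb_step
  leb_step0 leb_step_ge0 leb_step_sigma_additive.

Lemma sigma_finite_leb_step : sigma_finite setT leb_step.
Proof.
pose h (x : euclid R n.+1) : measurableTypeR R * euclid R n :=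
  (thead x, [tuple of behead x]).
have mh : measurable_fun setT h.
  apply: measurable_fun_pair; first exact: measurable_tnth.
  exact: measurable_behead.
have hK : cancel (@euclid_cons n) h.
  by move=> [a t]; congr pair; apply: val_inj.
have /sigma_finiteP[F [FT ndF Ffin]] :=
  sigma_finiteT (@lebesgue_measure R : {sigma_finite_measure set _ -> \bar R}).
have /sigma_finiteP[G [GT ndG Gfin]] := sigma_finiteT mu.
exists (fun i => h @^-1` (F i `*` G i)).
  rewrite -preimage_bigcup (_ : \bigcup_i _ = setT) ?preimage_setT//.
  rewrite -subTset => -[x y] _.
  have [i _ Fix] : (\bigcup_i F i) x by rewrite -FT.
  have [j _ Gjy] : (\bigcup_i G i) y by rewrite -GT.
  exists (maxn i j) => //; split => /=.
    by move: x Fix; exact/subsetPset/ndF/leq_maxl.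
  by move: y Gjy; exact/subsetPset/ndG/leq_maxr.
move=> i; have [mF finF] := Ffin i; have [mG finG] := Gfin i; split.
  by rewrite -[X in measurable X]setTI; apply: mh => //; exact: measurableX.
rewrite /leb_step /pushforward -comp_preimage.
rewrite (_ : h \o @euclid_cons n = id); last by apply/funext => z; exact: hK.
rewrite preimage_id product_measure1E//.
by rewrite lte_mul_pinfty// ge0_fin_numE.
Qed.

HB.instance Definition _ := Measure_isSigmaFinite.Build _ _ _
  leb_step sigma_finite_leb_step.

End Step.

(* Lebesgue measure on R^n: the n-fold product of the one-dimensional one;
   on R^0 it is the point mass. *)
Fixpoint leb n : {sigma_finite_measure set (euclid R n) -> \bar R} :=
  match n with
  | 0 => @dirac _ (euclid R 0) [tuple] R
  | m.+1 => @leb_step m (leb m)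
  end.

Lemma leb_box n (A : 'I_n -> set (measurableTypeR R)) :
  (forall i, measurable (A i)) ->
  leb n [set x | forall i, A i (tnth x i)] =
  (\prod_(i < n) lebesgue_measure (A i))%E.
Proof.
elim: n A => [|n IH] A mA.
  rewrite big_ord0 /= /dirac /= indicE mem_set//= => -[].
  by [].
rewrite big_ord_recl /= -IH // /leb_step /pushforward.
rewrite -[RHS]product_measure1E//; last first.
  rewrite (_ : [set x | _] =
    \bigcap_(i in [set: 'I_n]) ((@tnth _ _)^~ i @^-1` A (lift ord0 i))).
    apply: fin_bigcap_measurable => // i _.
    by rewrite -[X in measurable X]setTI; exact: measurable_tnth.
  by apply/seteqP; split => x /= H i; [move=> _|]; exact: H.
congr (product_measure1 _ _ _); apply/seteqP; split => -[a t] /=.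
  by move=> H; split; [exact: (H ord0)|move=> i; have := H (lift ord0 i); rewrite tnthS].
move=> [Ha Ht] i; case: (unliftP ord0 i) => [j ->|->] //.
by rewrite tnthS.
Qed.

End LebesgueMeasure.

Section Heat.
Context (R : realType) (n : nat).
Local Notation E := (euclid R n).
Implicit Types (x y : E) (t r : R).

Definition sqnorm x : R := \sum_(i < n) (tnth x i : R) ^+ 2.

Definition euclid_sub x y : E := [tuple (tnth x i - tnth y i : R) | i < n].

Definition eball r : set E := [set x | Num.sqrt (sqnorm x) < r].

Definition heat_kernel t x : R :=
  (4 * pi * t) `^ (- (n%:R / 2)) * expR (- (sqnorm x / (4 * t))).

(* e^{t Delta} f for t >= 0, with e^{0 Delta} the identity. *)
Definition heat_semigroup t (f : E -> R) (x : E) : R :=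
  if 0 < t then \int[leb R n]_y (heat_kernel t (euclid_sub x y) * f y) else f x.

(* Real-valued solution on [0, +oo) x R^n with initial datum in L^2(R^n).
   The value of u at negative times is unconstrained and never used. *)
Definition heat_solution (u : R -> E -> R) : Prop :=
  u 0 \in Lfun (leb R n) 2%:E /\
  forall t, 0 <= t -> forall x, u t x = heat_semigroup t (u 0) x.

End Heat.

Arguments eball {R} n r.

(* Main.v *)
Require Import Defs.
From HB Require Import structures.
From mathcomp Require Import all_boot all_order all_algebra.
From mathcomp Require Import all_classical all_reals all_analysis.
From mathcomp Require Import measurable_realfun ring lra.
Import Order.TTheory GRing.Theory Num.Theory.
Import numFieldNormedType.Exports.
Local Open Scope classical_set_scope.
Local Open Scope ring_scope.

(** Why the upper bound holds.  Let [f] be the initial datum and [u t] its evolution.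
    Since the kernel has mass 1, Jensen gives [u (t + h) ^ 2 <= e^{h Delta} (u t ^ 2)]
    pointwise ([heat_semigroup_jensen]); since the kernel is symmetric, for a weight
    [psi] this integrates to
    [int psi * u (t + h) ^ 2 <= int (e^{h Delta} psi) * u t ^ 2]
    ([integral_heat_semigroup_sqr_le]).  This replaces the differential inequality
    [(d/dt - Delta) u ^ 2 <= 0] and needs no derivative of [u].  The weight is the
    squared distance to the complement of a ball of radius [b] between [r'] and [r],
    rescaled and capped at 1.  It is the minimum of 1 and of the paraboloids
    [M * |x - p| ^ 2], [|p| >= b], with [M] of order [(r - r') ^- 2]; a Gaussian average
    raises each of them by at most [16 n M h], so
    [e^{h Delta} psi <= psi + 16 n M h] everywhere, while outside the ball of radius [r]
    the left-hand side is a Gaussian tail, of order [h ^ 2]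
    ([integral_kernel_cutoff_ball]).  Hence the weighted energy [g t] grows over a time
    step [h] by at most [16 n M h] times the energy [v t] in the ball of radius [r], up
    to [O (h ^ 2)] ([energy_step]).  Integrating the resulting inequality for [t * g t]
    over [t] in [0, T - h], cancelling the common part of the two sides, dividing by [h]
    and letting [h] tend to 0 bounds [T * g T] by [1 + 16 n M T] times the integral of
    [v] over [0, T] ([time_average]).

    All Gaussian facts reduce to the line: the kernel is a product of one-dimensional
    normal densities ([heat_kernel_prod]) and Lebesgue measure is a product measure
    ([integral_leb_prod]).

    Why the converse bound fails.  A Gaussian datum centred at distance [L] from the
    origin evolves explicitly.  Between times 0 and [T], its square is at most
    [exp (- (L - r) ^ 2 / (2 (1 + T)))] on the ball of radius [r], but at time [T] it
    is at least of order [exp (- (L - r1) ^ 2 / (2 (1 + T)))] near the point of the axis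
    at distance [r1], for [r < r1 < r'].  The ratio grows exponentially with [L]
    ([no_outer_bound]). *)

(** * Shifts and reflections of the line *)

Section Line.
Context {R : realType}.
Local Notation mu := (@lebesgue_measure R).

Lemma ge0_integral_shift (a : R) (D : set R) (f : R -> \bar R) :
  measurable D -> measurable_fun D f -> (forall x, D x -> (0 <= f x)%E) ->
  (\int[mu]_(x in +%R a @^-1` D) f (a + x)%R = \int[mu]_(x in D) f x)%E.
Proof.
move=> mD mf f0.
have ma : measurable_fun [set: measurableTypeR R] (+%R a : _ -> measurableTypeR R).
  exact: measurable_funD.
rewrite -[LHS](ge0_integral_pushforward ma mu mD mf); last first.
  by move=> x /set_mem; exact: f0.
apply: eq_measure_integral => /= A mA _; apply/esym.
pose pushed := pushforward mu (+%R a : _ -> measurableTypeR R).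
pose mphi := isMeasurableFun.Build _ _ _ _ _ ma.
pose phi : {mfun measurableTypeR R >-> measurableTypeR R} := HB.pack (+%R a) mphi.
apply: (@lebesgue_measure_unique R (pushforward mu phi)) => // _ [[u v]] _ <-.
rewrite /pushforward/=.
rewrite [X in _ = lebesgue_measure X](_ : _ = `]u - a, v - a]%classic); last first.
  by apply/seteqP; split => x /=; rewrite !in_itv/= ltrBlDl lerBrDl.
rewrite !lebesgue_measure_itv/= !lte_fin ltrD2r.
by case: ifP => // _; rewrite -!EFinD opprB addrA subrK.
Qed.

Lemma ge0_integral_reflect (a : R) (f : R -> \bar R) :
  measurable_fun setT f -> (forall x, 0 <= f x)%E ->
  (\int[mu]_x f (a - x)%R = \int[mu]_x f x)%E.
Proof.
move=> mf f0.
have ma : measurable_fun [set: measurableTypeR R] (fun x => a - x : measurableTypeR R).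
  exact: measurable_funB.
rewrite -[X in integral mu X](@preimage_setT _ _ (fun x => a - x)).
rewrite -[LHS](ge0_integral_pushforward ma mu measurableT mf)//.
apply: eq_measure_integral => /= A mA _; apply/esym.
pose mphi := isMeasurableFun.Build _ _ _ _ _ ma.
pose phi : {mfun measurableTypeR R >-> measurableTypeR R} := HB.pack (fun x => a - x) mphi.
apply: (@lebesgue_measure_unique R (pushforward mu phi)) => // _ [[u v]] _ <-.
rewrite /pushforward/=.
rewrite [X in _ = lebesgue_measure X](_ : _ = `[a - v, a - u[%classic); last first.
  by apply/seteqP; split => x /=; rewrite !in_itv/= lerBlDl -lerBlDr ltrBrDl -ltrBrDr andbC.
rewrite !lebesgue_measure_itv/= !lte_fin ltrD2l ltrN2.
by case: ifP => // _; rewrite -!EFinD; congr EFin; ring.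
Qed.

End Line.

(** * The Gaussian kernel on the line *)

Section Gauss.
Context {R : realType}.
Local Notation mu := (@lebesgue_measure R).
Implicit Types t s m x y z : R.

Definition gauss t m x : R :=
  (Num.sqrt (4 * pi * t))^-1 * expR (- ((x - m) ^+ 2 / (4 * t))).

Lemma gauss_ge0 t m x : 0 <= gauss t m x.
Proof. by rewrite mulr_ge0 ?expR_ge0// invr_ge0. Qed.

Lemma gaussC t m x : gauss t m x = gauss t x m.
Proof. by rewrite /gauss -sqrrN opprB. Qed.

Lemma gauss_normal t m : 0 < t -> gauss t m = normal_pdf m (Num.sqrt (2 * t)).
Proof.
move=> t0; have s0 : 0 < Num.sqrt (2 * t) by rewrite sqrtr_gt0 mulr_gt0.
apply/funext => x; rewrite normal_pdfE ?gt_eqF// /normal_peak /normal_fun.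
rewrite sqr_sqrtr ?mulr_ge0 ?ltW// /gauss; congr (_^-1 * expR _).
  by congr Num.sqrt; rewrite -mulr_natl; ring.
by rewrite mulNr; congr (- (_ / _)); rewrite -mulr_natl; ring.
Qed.

Lemma measurable_gauss t m : measurable_fun setT (gauss t m).
Proof.
apply: measurable_funM => //; apply: measurableT_comp => //.
apply: measurableT_comp => //; apply: measurable_funM => //.
by apply: measurable_funX; exact: measurable_funB.
Qed.

Lemma integral_gauss t m : 0 < t -> (\int[mu]_x (gauss t m x)%:E = 1)%E.
Proof. by move=> t0; rewrite gauss_normal// integral_normal_pdf. Qed.

Lemma ge0_integral_gaussZ t m (k : R) : 0 < t -> 0 <= k ->
  (\int[mu]_x (k * gauss t m x)%:E = k%:E)%E.
Proof.
move=> t0 k0; under eq_integral do rewrite EFinM.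
rewrite ge0_integralZl_EFin// ?integral_gauss ?mule1//.
- by move=> x _; rewrite lee_fin gauss_ge0.
- by apply/measurable_EFinP; exact: measurable_gauss.
Qed.

(** Completing the square: as a function of [z], the product of the two kernels
    is a multiple of a third one, centred at a weighted mean of [x] and [y]. *)
Lemma gauss_chapman_kolmogorov s t x y : 0 < s -> 0 < t ->
  (\int[mu]_z (gauss s y z * gauss t z x)%:E = (gauss (s + t) y x)%:E)%E.
Proof.
move=> s0 t0; have st0 : 0 < s + t by rewrite addr_gt0.
rewrite -(@ge0_integral_gaussZ (s * t / (s + t)) ((t * y + s * x) / (s + t)))
  ?gauss_ge0//; last by rewrite divr_gt0// mulr_gt0.
apply: eq_integral => z _; congr EFin; rewrite /gauss.
rewrite mulrACA -expRD mulrACA -expRD -!invfM; congr (_^-1 * expR _).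
  rewrite -!sqrtrM ?mulr_ge0 ?pi_ge0 ?ltW//; congr Num.sqrt.
  by field; rewrite gt_eqF.
by field; rewrite ?gt_eqF.
Qed.

Lemma expR_half_le2 : expR (2^-1 : R) <= 2.
Proof.
rewrite -[leRHS]invrK -[leLHS]invrK -expRN lef_pV2 ?posrE ?expR_gt0 ?invr_gt0//.
by apply: le_trans (expR_ge1Dx _); lra.
Qed.

(** Tilting the kernel by an exponential only moves its centre and multiplies its mass
    by a constant; an even power is dominated by two such exponentials, since
    [y ^ (k + 1) <= (k + 1)! (exp y + exp (- y))]. *)
Lemma integral_gauss_even_moment t m k : 0 < t -> odd k ->
  (\int[mu]_x (gauss t m x * (x - m) ^+ k.+1)%:E <=
     (4 * (k.+1)`!%:R * Num.sqrt (2 * t) ^+ k.+1)%:E)%E.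
Proof.
move=> t0 k_odd; set sg := Num.sqrt (2 * t).
have sg0 : 0 < sg by rewrite sqrtr_gt0 mulr_gt0.
have sg2 : sg ^+ 2 = 2 * t by rewrite sqr_sqrtr// mulr_ge0// ltW.
have tE : t = sg ^+ 2 / 2 by rewrite sg2; field.
set c := (k.+1)`!%:R * sg ^+ k.+1.
have c0 : 0 <= c by rewrite mulr_ge0// exprn_ge0// ltW.
have even_pow (y : R) : y ^+ k.+1 = `|y| ^+ k.+1.
  by rewrite -normrX ger0_norm// exprn_even_ge0//= k_odd.
have pow_le (y : R) : y ^+ k.+1 <= (k.+1)`!%:R * (expR y + expR (- y)).
  rewrite even_pow -ler_pdivrMl; last by rewrite ltr0n fact_gt0.
  rewrite mulrC; apply: (@le_trans _ _ (expR `|y|)).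
    by apply: le_trans (expR_ge1Dxn k _); rewrite ?lerDr.
  by case: ger0P => _; [rewrite lerDl|rewrite lerDr]; exact: expR_ge0.
have shift (b : R) x : b ^+ 2 = sg ^+ 2 ->
    gauss t m x * expR ((x - m) / b) = expR (2^-1) * gauss t (m + b) x.
  move=> b2; have b_neq0 : b != 0.
    by rewrite -sqrf_eq0 b2 sqrf_eq0 gt_eqF.
  rewrite /gauss; set P := (Num.sqrt _)^-1; rewrite -mulrA -expRD mulrCA -expRD; congr (_ * expR _).
  by rewrite tE -b2; field.
apply: (@le_trans _ _ (\int[mu]_x ((c * expR 2^-1) * gauss t (m + sg) x +
    (c * expR 2^-1) * gauss t (m - sg) x)%:E)%E).
  apply: ge0_le_integral => //.
  - by move=> x _; rewrite lee_fin mulr_ge0 ?gauss_ge0// even_pow exprn_ge0.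
  - apply/measurable_EFinP; apply: measurable_funM; first exact: measurable_gauss.
    by apply: measurable_funX; exact: measurable_funB.
  - by apply/measurable_EFinP; apply: measurable_funD; apply: measurable_funM => //;
      exact: measurable_gauss.
  move=> x _; rewrite lee_fin; set w := (x - m) / sg.
  rewrite [leRHS](_ : _ = gauss t m x * (c * (expR w + expR (- w)))); last first.
    rewrite -[c * _ * gauss t (m + sg) x]mulrA -[c * _ * gauss t (m - sg) x]mulrA.
    by rewrite -!shift ?sqrrN// invrN mulrN -/w; ring.
  rewrite ler_wpM2l ?gauss_ge0//.
  have -> : x - m = w * sg by rewrite divfK// gt_eqF.
  by rewrite /c exprMn mulrAC ler_wpM2r ?pow_le// exprn_ge0// ltW.
under eq_integral do rewrite EFinD.
rewrite ge0_integralD//.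
- have k0 : 0 <= c * expR 2^-1 by rewrite mulr_ge0 ?expR_ge0.
  rewrite !ge0_integral_gaussZ// -EFinD lee_fin -mulrDr.
  rewrite -mulrA -/c [leRHS]mulrC; apply: ler_wpM2l => //.
  by have := expR_half_le2; lra.
- by move=> x _; rewrite lee_fin mulr_ge0 ?gauss_ge0// mulr_ge0 ?expR_ge0.
- apply/measurable_EFinP; apply: measurable_funM => //; exact: measurable_gauss.
- by move=> x _; rewrite lee_fin mulr_ge0 ?gauss_ge0// mulr_ge0 ?expR_ge0.
- apply/measurable_EFinP; apply: measurable_funM => //; exact: measurable_gauss.
Qed.

(** The first moment vanishes by symmetry: adding to the integral its image under
    the reflection about [m] leaves only the variance and [(m - a) ^ 2]. *)
Lemma integral_gauss_sqr t m (a : R) : 0 < t ->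
  (\int[mu]_x (gauss t m x * (x - a) ^+ 2)%:E <= ((m - a) ^+ 2 + 16 * t)%:E)%E.
Proof.
move=> t0.
have mg b : measurable_fun setT (fun x => (gauss t m x * (x - b) ^+ 2)%:E).
  apply/measurable_EFinP; apply: measurable_funM; first exact: measurable_gauss.
  by apply: measurable_funX; exact: measurable_funB.
have g0 b x : (0 <= (gauss t m x * (x - b) ^+ 2)%:E)%E.
  by rewrite lee_fin mulr_ge0 ?gauss_ge0 ?sqr_ge0.
set I := (X in (X <= _)%E).
have I0 : (0 <= I)%E by exact: integral_ge0.
have Irefl : I = (\int[mu]_x (gauss t m x * (2 * m - a - x) ^+ 2)%:E)%E.
  rewrite /I -[LHS](ge0_integral_reflect (2 * m) _ (mg a))//.
  apply: eq_integral => x _; congr EFin; rewrite /gauss; congr (_ * expR _ * _); last by ring.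
  by congr (- (_ / _)); ring.
have I2 : (I + I <= (2 * ((m - a) ^+ 2 + 16 * t))%:E)%E.
  rewrite {2}Irefl -ge0_integralD//; last 3 first.
  - exact: mg.
  - by move=> x _; rewrite lee_fin mulr_ge0 ?gauss_ge0 ?sqr_ge0.
  - apply/measurable_EFinP; apply: measurable_funM; first exact: measurable_gauss.
    by apply: measurable_funX; apply: measurable_funB.
  have sum_sqr x : gauss t m x * (x - a) ^+ 2 + gauss t m x * (2 * m - a - x) ^+ 2 =
      2 * (gauss t m x * (x - m) ^+ 2) + 2 * (m - a) ^+ 2 * gauss t m x by ring.
  under eq_integral => x _ do rewrite -EFinD sum_sqr EFinD EFinM.
  rewrite ge0_integralD//; last 4 first.
  - by move=> x _; rewrite mule_ge0.
  - by apply: emeasurable_funM => //; exact: mg.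
  - by move=> x _; rewrite lee_fin mulr_ge0 ?gauss_ge0// mulr_ge0 ?sqr_ge0.
  - by apply/measurable_EFinP; apply: measurable_funM => //; exact: measurable_gauss.
  have k0 : 0 <= 2 * (m - a) ^+ 2 by rewrite mulr_ge0// sqr_ge0.
  rewrite ge0_integral_gaussZ// ge0_integralZl_EFin//; last first.
    exact: mg.
  have H : (2%:E * \int[mu]_x (gauss t m x * (x - m) ^+ 2)%:E <=
      2%:E * (16 * t)%:E)%E.
    apply: lee_wpmul2l; first by rewrite lee_fin.
    apply: le_trans (integral_gauss_even_moment t m 1 t0 isT) _.
    rewrite lee_fin sqr_sqrtr ?mulr_ge0 ?(ltW t0)// (_ : (2`!)%:R = 2)//; lra.
  apply: le_trans (leeD2r _ H) _.
  by rewrite -EFinM -EFinD lee_fin; lra.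
move: I2 I0; clear; case: I => [r| |]//; rewrite -?EFinD ?lee_fin//.
by move=> ? _; lra.
Qed.

End Gauss.

(** * The heat kernel on [R^n] *)

Section Kernel.
Context {R : realType}.
Local Notation mu := (@lebesgue_measure R).

Lemma measurable_tnth_comp {d} {T : measurableType d} n (f : T -> euclid R n) i :
  measurable_fun setT f -> measurable_fun setT (fun w => tnth (f w) i : R).
Proof. by move=> mf; apply: (measurableT_comp (measurable_tnth i)). Qed.

(** Tonelli, one coordinate at a time.  The one-dimensional integrals are given as
    reals [c i] so that their product can be taken in [R]. *)
Lemma integral_leb_prod n (g : 'I_n -> R -> R) (c : 'I_n -> R) :
  (forall i, measurable_fun setT (g i)) -> (forall i z, 0 <= g i z) ->
  (forall i, (\int[mu]_z (g i z)%:E = (c i)%:E)%E) ->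
  (\int[leb R n]_x (\prod_(i < n) g i (tnth x i))%:E = (\prod_(i < n) c i)%:E)%E.
Proof.
elim: n g c => [|n IH] g c mg g0 gc.
  rewrite big_ord0 /= integral_dirac ?diracT ?mul1e ?big_ord0//.
  by apply/measurable_EFinP; apply: measurable_prod => -[].
have mprod m (h : 'I_m -> R -> R) : (forall i, measurable_fun setT (h i)) ->
    measurable_fun setT (fun x : euclid R m => (\prod_(i < m) h i (tnth x i))%:E).
  move=> mh; apply/measurable_EFinP; apply: measurable_prod => i _.
  by apply: (measurableT_comp (mh i)); exact: measurable_tnth.
have prod0 m (h : 'I_m -> R -> R) (x : euclid R m) : (forall i z, 0 <= h i z) ->
    (0 <= (\prod_(i < m) h i (tnth x i))%:E)%E.
  by move=> h0; rewrite lee_fin prodr_ge0.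
rewrite /= /leb_step (ge0_integral_pushforward (@measurable_euclid_cons R n))//; first last.
- by move=> x _; exact: prod0.
- exact: mprod.
rewrite preimage_setT fubini_tonelli1//=; first last.
- by move=> x /=; exact: prod0.
- exact: (measurableT_comp (mprod _ _ mg) (@measurable_euclid_cons R n)).
rewrite /fubini_F/=.
under eq_integral => a _.
  under eq_integral => x _.
    rewrite big_ord_recl; under eq_bigr => i _ do rewrite tnthS.
    rewrite (tnth0 a x) EFinM; over.
  rewrite ge0_integralZl_EFin//; last 2 first.
  - by move=> x _; exact: (prod0 n (fun i => g (lift ord0 i))).
  - exact: (mprod n (fun i => g (lift ord0 i))).
  rewrite (IH (fun i => g (lift ord0 i)) (fun i => c (lift ord0 i)))// muleC; over.
have c0 i : 0 <= c i.
  by rewrite -lee_fin -gc; apply: integral_ge0 => z _; rewrite lee_fin.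
rewrite ge0_integralZl_EFin//; last 3 first.
- by move=> x _; rewrite lee_fin.
- by apply/measurable_EFinP; exact: mg.
- exact: prodr_ge0.
by rewrite gc -EFinM big_ord_recl mulrC.
Qed.

Section Dim.
Context {n : nat}.
Local Notation E := (euclid R n).
Implicit Types (t s : R) (x y z : E).
Local Notation K t x y := (heat_kernel t (euclid_sub x y)).

Lemma sqnorm_sub x y :
  sqnorm (euclid_sub x y) = \sum_(i < n) (tnth x i - tnth y i : R) ^+ 2.
Proof. by apply: eq_bigr => i _; rewrite tnth_mktuple. Qed.

Lemma sqnorm_subC x y : sqnorm (euclid_sub x y) = sqnorm (euclid_sub y x).
Proof. by rewrite !sqnorm_sub; apply: eq_bigr => i _; rewrite -sqrrN opprB. Qed.

Lemma sqnorm_ge0 x : 0 <= sqnorm x.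
Proof. by apply: sumr_ge0 => i _; exact: sqr_ge0. Qed.

Lemma heat_kernelC t x y : K t x y = K t y x.
Proof. by rewrite /heat_kernel sqnorm_subC. Qed.

Lemma heat_kernel_ge0 t x : 0 <= heat_kernel t x.
Proof. by rewrite mulr_ge0 ?powR_ge0 ?expR_ge0. Qed.

Definition kernel_peak t : R := (4 * pi * t) `^ (- (n%:R / 2)).

Lemma kernel_peak_ge0 t : 0 <= kernel_peak t. Proof. exact: powR_ge0. Qed.

Lemma heat_kernel_le_peak t x : 0 < t -> heat_kernel t x <= kernel_peak t.
Proof.
move=> t0; rewrite ler_piMr ?powR_ge0// -expR0 ler_expR oppr_le0.
by rewrite divr_ge0 ?sqnorm_ge0// mulr_ge0// ltW.
Qed.

Lemma heat_kernel_prod t x y : 0 < t ->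
  K t x y = \prod_(i < n) gauss t (tnth y i) (tnth x i).
Proof.
move=> t0; rewrite big_split/= prodr_const card_ord -expR_sum; congr (_ * expR _).
  have c0 : 0 <= 4 * pi * t by rewrite !mulr_ge0 ?pi_ge0 ?(ltW t0).
  by rewrite powRN [n%:R / 2]mulrC powRrM powR12_sqrt// powR_mulrn ?sqrtr_ge0// exprVn.
by rewrite sumrN -mulr_suml sqnorm_sub.
Qed.

(** Joint measurability in time and space, as Tonelli in time will need.  Restricting
    to positive times allows the inverse of [4 * t] to be written as a real power. *)
Lemma measurable_heat_kernel_guarded {d} {T : measurableType d}
    (ft : T -> R) (fx fy : T -> E) :
  measurable_fun setT ft -> measurable_fun setT fx -> measurable_fun setT fy ->
  measurable_fun setT (fun w => if 0 < ft w then K (ft w) (fx w) (fy w) else 0).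
Proof.
move=> mt mx my.
rewrite (_ : (fun w => _) = fun w => if 0 < ft w then
    kernel_peak (ft w) *
    expR (- (sqnorm (euclid_sub (fx w) (fy w)) * (4 * ft w) `^ (-1))) else 0); last first.
  apply/funext => w; case: ifPn => // t0.
  by rewrite powR_inv1// mulr_ge0// ltW.
apply: measurable_fun_ifT => //; first exact: measurable_fun_ltr.
apply: measurable_funM.
  by apply: (measurableT_comp (measurable_powR _)); exact: measurable_funM.
apply: measurableT_comp => //; apply: measurableT_comp => //; apply: measurable_funM.
  rewrite (_ : (fun w => _) =
    fun w => \sum_(i < n) (tnth (fx w) i - tnth (fy w) i : R) ^+ 2); last first.
    by apply/funext => w; exact: sqnorm_sub.
  apply: measurable_sum => i; apply: measurable_funX.
  by apply: measurable_funB; exact: measurable_tnth_comp.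
by apply: (measurableT_comp (measurable_powR _)); exact: measurable_funM.
Qed.

Lemma measurable_heat_kernel {d} {T : measurableType d} t (fx fy : T -> E) :
  0 < t -> measurable_fun setT fx -> measurable_fun setT fy ->
  measurable_fun setT (fun w => K t (fx w) (fy w)).
Proof.
move=> t0 mx my.
have := @measurable_heat_kernel_guarded _ _ (cst t) _ _ (measurable_cst _) mx my.
by rewrite /= t0.
Qed.

Lemma heat_kernel_chapman_kolmogorov s t x y : 0 < s -> 0 < t ->
  (\int[leb R n]_z (K t x z * K s z y)%:E = (K (s + t) x y)%:E)%E.
Proof.
move=> s0 t0; rewrite (heat_kernel_prod (s + t)) ?addr_gt0//.
rewrite -(integral_leb_prod n
  (fun i (z : R) => gauss s (tnth y i) z * gauss t z (tnth x i))
  (fun i => gauss (s + t) (tnth y i) (tnth x i)))//; last 3 first.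
- move=> i; apply: measurable_funM; first exact: measurable_gauss.
  rewrite (_ : gauss t ^~ _ = gauss t (tnth x i)); first exact: measurable_gauss.
  by apply/funext => z; rewrite gaussC.
- by move=> i z; rewrite mulr_ge0 ?gauss_ge0.
- by move=> i; exact: gauss_chapman_kolmogorov.
apply: eq_integral => z _; rewrite !heat_kernel_prod// -big_split/=.
by congr EFin; apply: eq_bigr => i _; rewrite mulrC.
Qed.

(** The other coordinates integrate to 1, so a function of one coordinate is averaged
    by the one-dimensional kernel.  An upper bound [c] ensures finiteness. *)
Lemma integral_heat_kernel_coord t y i (phi : R -> R) (c : R) :
  0 < t ->
  measurable_fun setT phi -> (forall a, 0 <= phi a) ->
  (\int[mu]_z (gauss t (tnth y i) z * phi z)%:E <= c%:E)%E ->
  (\int[leb R n]_x (K t x y * phi (tnth x i))%:E <= c%:E)%E.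
Proof.
move=> t0 mphi phi0 intc.
set I := (\int[mu]_z _)%E in intc.
have I0 : (0 <= I)%E.
  by apply: integral_ge0 => z _; rewrite lee_fin mulr_ge0 ?gauss_ge0.
have If : I = (fine I)%:E.
  by rewrite fineK// ge0_fin_numE// (le_lt_trans intc)// ltry.
rewrite (_ : (\int[_]_x _)%E = I)// If.
rewrite (_ : fine I = \prod_(j < n) (if j == i then fine I else 1)); last first.
  by rewrite -big_mkcond big_pred1_eq.
rewrite -(integral_leb_prod n (fun j (z : R) => gauss t (tnth y j) z *
  (if j == i then phi z else 1))
  (fun j => if j == i then fine I else 1))//; last 3 first.
- move=> j; apply: measurable_funM; first exact: measurable_gauss.
  by case: eqP.
- by move=> j z; rewrite mulr_ge0 ?gauss_ge0//; case: eqP.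
- move=> j; case: eqP => [->//|_].
  by under eq_integral do rewrite mulr1; exact: integral_gauss.
apply: eq_integral => x _; rewrite heat_kernel_prod// [in RHS]big_split/=.
by rewrite -big_mkcond big_pred1_eq.
Qed.

Lemma integral_heat_kernel t y : 0 < t ->
  (\int[leb R n]_x (K t x y)%:E = 1)%E.
Proof.
move=> t0; transitivity ((\prod_(i < n) 1 : R)%:E); last by rewrite big1_eq.
rewrite -(integral_leb_prod n (fun i => gauss t (tnth y i)))//.
- by apply: eq_integral => x _; rewrite heat_kernel_prod.
- by move=> i; exact: measurable_gauss.
- by move=> i z; exact: gauss_ge0.
- by move=> i; exact: integral_gauss.
Qed.

Lemma integral_heat_kernel_sum t y (phi : 'I_n -> R -> R) (c : 'I_n -> R) :
  0 < t -> (forall i, measurable_fun setT (phi i)) -> (forall i a, 0 <= phi i a) ->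
  (forall i, (\int[mu]_z (gauss t (tnth y i) z * phi i z)%:E <= (c i)%:E)%E) ->
  (\int[leb R n]_x (K t x y * \sum_(i < n) phi i (tnth x i))%:E <=
    (\sum_(i < n) c i)%:E)%E.
Proof.
move=> t0 mphi phi0 intc.
have -> : (\int[leb R n]_x (K t x y * \sum_(i < n) phi i (tnth x i))%:E =
    \int[leb R n]_x \sum_(i < n) (K t x y * phi i (tnth x i))%:E)%E.
  by apply: eq_integral => x _; rewrite sumEFin mulr_sumr.
rewrite ge0_integral_sum//.
- by rewrite -sumEFin; apply: lee_sum => i _; exact: integral_heat_kernel_coord.
- move=> i; apply/measurable_EFinP; apply: measurable_funM.
    exact: (measurable_heat_kernel t id (cst y)).
  by apply: (measurableT_comp (mphi i)); exact: measurable_tnth.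
- by move=> i x _; rewrite lee_fin mulr_ge0 ?heat_kernel_ge0.
Qed.

Lemma integral_heat_kernel_sqr t y a : 0 < t ->
  (\int[leb R n]_x (K t x y * sqnorm (euclid_sub x a))%:E <=
    (sqnorm (euclid_sub y a) + 16 * n%:R * t)%:E)%E.
Proof.
move=> t0; under eq_integral do rewrite sqnorm_sub.
rewrite [leRHS](_ : _ =
    (\sum_(i < n) ((tnth y i - tnth a i) ^+ 2 + 16 * t))%:E); last first.
  rewrite sqnorm_sub big_split/= sumr_const card_ord; congr (_ + _)%:E.
  by rewrite -mulr_natr; ring.
apply: (integral_heat_kernel_sum t y (fun i (z : R) => (z - tnth a i) ^+ 2)) => //.
- by move=> i; apply: measurable_funX; exact: measurable_funB.
- by move=> i z; exact: sqr_ge0.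
- by move=> i; exact: integral_gauss_sqr.
Qed.

Lemma sqr_sum_le (b : 'I_n -> R) :
  (\sum_(i < n) b i) ^+ 2 <= n%:R * \sum_(i < n) b i ^+ 2.
Proof.
rewrite expr2 big_distrlr/=.
apply: (@le_trans _ _ (\sum_(i < n) \sum_(j < n) (b i ^+ 2 / 2 + b j ^+ 2 / 2))).
  apply: ler_sum => i _; apply: ler_sum => j _.
  by have := sqr_ge0 (b i - b j); lra.
rewrite [leLHS](eq_bigr
  (fun i => n%:R * (b i ^+ 2 / 2) + \sum_(j < n) b j ^+ 2 / 2)); last first.
  by move=> i _; rewrite big_split/= sumr_const card_ord mulr_natl.
rewrite big_split/= -mulr_sumr -!mulr_suml sumr_const card_ord -mulr_natl.
by lra.
Qed.

Lemma integral_heat_kernel_fourth t y : 0 < t ->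
  (\int[leb R n]_x (K t x y * sqnorm (euclid_sub x y) ^+ 2)%:E <=
    (384 * n%:R ^+ 2 * t ^+ 2)%:E)%E.
Proof.
move=> t0.
apply: (@le_trans _ _ (\int[leb R n]_x (K t x y *
    \sum_(i < n) n%:R * (tnth x i - tnth y i : R) ^+ 4)%:E)%E).
  apply: ge0_le_integral => //.
  - by move=> x _; rewrite lee_fin mulr_ge0 ?heat_kernel_ge0// sqr_ge0.
  - apply/measurable_EFinP; apply: measurable_funM.
      exact: (measurable_heat_kernel t id (cst y)).
    apply: measurable_funX; under eq_fun do rewrite sqnorm_sub.
    apply: measurable_sum => i; apply: measurable_funX.
    by apply: measurable_funB => //; exact: measurable_tnth_comp.
  - apply/measurable_EFinP; apply: measurable_funM.
      exact: (measurable_heat_kernel t id (cst y)).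
    apply: measurable_sum => i; apply: measurable_funM => //; apply: measurable_funX.
    by apply: measurable_funB => //; exact: measurable_tnth_comp.
  move=> x _; rewrite lee_fin ler_wpM2l ?heat_kernel_ge0// sqnorm_sub.
  apply: le_trans (sqr_sum_le _) _; rewrite mulr_sumr; apply: ler_sum => i _.
  by rewrite -exprM.
rewrite [leRHS](_ : _ = (\sum_(i < n) n%:R * (384 * t ^+ 2))%:E); last first.
  by rewrite sumr_const card_ord -mulr_natr; congr EFin; ring.
apply: (integral_heat_kernel_sum t y (fun i (z : R) => n%:R * (z - tnth y i) ^+ 4)) => //.
- move=> i; apply: measurable_funM => //; apply: measurable_funX.
  exact: measurable_funB.
- by move=> i z; rewrite mulr_ge0// exprn_even_ge0.
- move=> i; under eq_integral do rewrite mulrCA EFinM.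
  rewrite ge0_integralZl_EFin//; last 2 first.
  + by move=> z _; rewrite lee_fin mulr_ge0 ?gauss_ge0// exprn_even_ge0.
  + apply/measurable_EFinP; apply: measurable_funM; first exact: measurable_gauss.
    by apply: measurable_funX; exact: measurable_funB.
  rewrite EFinM; apply: lee_wpmul2l; first by rewrite lee_fin.
  apply: le_trans (integral_gauss_even_moment t (tnth y i) 3 t0 isT) _.
  rewrite lee_fin (_ : Num.sqrt (2 * t) ^+ 4 = (2 * t) ^+ 2).
    by rewrite (_ : 4`!%:R = 24)//; lra.
  by rewrite (exprM _ 2 2) sqr_sqrtr// mulr_ge0// ltW.
Qed.

End Dim.
End Kernel.
Arguments kernel_peak {R} n t.

(** * The heat semigroup on square-integrable functions *)

Section Semigroup.
Context {R : realType} {n : nat}.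
Local Notation E := (euclid R n).
Local Notation leb := (leb R n).
Implicit Types (t s : R) (x y z : E) (f : E -> R).
Local Notation K t x y := (heat_kernel t (euclid_sub x y)).

Definition square_integrable f :=
  measurable_fun setT f /\ leb.-integrable setT (fun y => (f y ^+ 2)%:E).

Lemma measurable_heat_kernel1 t x : 0 < t -> measurable_fun setT (fun y : E => K t x y).
Proof. by move=> t0; exact: (measurable_heat_kernel t (cst x) id). Qed.

Lemma integrable_heat_kernel t x : 0 < t ->
  leb.-integrable setT (fun y => (K t x y)%:E).
Proof.
move=> t0; apply/integrableP; split.
  by apply/measurable_EFinP; exact: measurable_heat_kernel1.
under eq_integral => y _ do rewrite gee0_abs ?lee_fin ?heat_kernel_ge0// heat_kernelC.
by rewrite integral_heat_kernel// ltry.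
Qed.

Lemma integrable_heat_kernel_sqr t x f : 0 < t -> square_integrable f ->
  leb.-integrable setT (fun y => (K t x y * f y ^+ 2)%:E).
Proof.
move=> t0 [mf f2].
apply: (le_integrable measurableT _ _ (integrableZl measurableT (kernel_peak n t) f2)).
  apply/measurable_EFinP; apply: measurable_funM; first exact: measurable_heat_kernel1.
  exact: measurable_funX.
move=> y _; rewrite -EFinM !abse_EFin lee_fin.
rewrite (ger0_norm (mulr_ge0 (heat_kernel_ge0 _ _) (sqr_ge0 _))).
rewrite (ger0_norm (mulr_ge0 (kernel_peak_ge0 _) (sqr_ge0 _))).
by rewrite ler_wpM2r ?sqr_ge0// heat_kernel_le_peak.
Qed.

(** The kernel is both integrable and bounded, and [|f| <= 1 + f ^ 2]. *)
Lemma integrable_heat_kernel_mul t x f : 0 < t -> square_integrable f ->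
  leb.-integrable setT (fun y => (K t x y * f y)%:E).
Proof.
move=> t0 f2; have [mf _] := f2.
apply: (le_integrable measurableT _ _ (integrableD measurableT
  (integrable_heat_kernel t x t0) (integrable_heat_kernel_sqr t x f t0 f2))).
  by apply/measurable_EFinP; apply: measurable_funM => //; exact: measurable_heat_kernel1.
move=> y _; rewrite /= lee_fin -[X in `|X + _|]mulr1 -mulrDr.
rewrite [leLHS]normrM [leRHS]normrM.
rewrite ler_wpM2l// [leRHS]ger0_norm ?addr_ge0 ?sqr_ge0//.
rewrite -(real_normK (num_real (f y))).
by have := sqr_ge0 (`|f y| - 1); have := sqr_ge0 `|f y|; lra.
Qed.

Lemma heat_semigroupE t x f : 0 < t -> square_integrable f ->
  (heat_semigroup t f x)%:E = (\int[leb]_y (K t x y * f y)%:E)%E.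
Proof.
move=> t0 f2; rewrite /heat_semigroup t0 /Rintegral fineK//.
by apply: integrable_fin_num => //; exact: integrable_heat_kernel_mul.
Qed.

Lemma measurable_fun_heat_semigroup f : measurable_fun setT f ->
  measurable_fun setT (fun w : measurableTypeR R * E => heat_semigroup w.1 f w.2).
Proof.
move=> mf; rewrite /heat_semigroup.
pose F (w : (measurableTypeR R * E) * E) :=
  ((if 0 < w.1.1 then K w.1.1 w.1.2 w.2 else 0) * f w.2)%:E.
have mF : measurable_fun setT F.
  apply/measurable_EFinP; apply: measurable_funM; last exact: measurableT_comp.
  apply: (measurable_heat_kernel_guarded (fun w => w.1.1) (fun w => w.1.2) snd) => //.
  - exact: (measurableT_comp measurable_fst measurable_fst).
  - exact: (measurableT_comp measurable_snd measurable_fst).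
rewrite (_ : (fun w => _) = fun w : measurableTypeR R * E => if 0 < w.1 then
    fine (\int[leb]_y F (w, y)) else f w.2); last first.
  by apply/funext => w; rewrite /Rintegral /F/=; case: ifPn.
apply: measurable_fun_ifT.
- by apply: measurable_fun_ltr => //; exact: measurable_fst.
- apply: (measurableT_comp (fine_measurable measurableT)) => /=.
  rewrite (_ : (fun w => _) = fun w => (\int[leb]_y (F^\+ (w, y)) -
    \int[leb]_y (F^\- (w, y)))%E); last first.
    by apply/funext => w; rewrite [LHS]integralE; congr (_ - _)%E; apply: eq_integral => y _;
      rewrite ?funeposE ?funenegE.
  apply: emeasurable_funB.
  + by apply: (measurable_fun_fubini_tonelli_F (F^\+)%E) => //; exact: measurable_funepos.
  + by apply: (measurable_fun_fubini_tonelli_F (F^\-)%E) => //; exact: measurable_funeneg.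
- by apply: measurableT_comp => //; exact: measurable_snd.
Qed.

Lemma measurable_heat_semigroup t f : measurable_fun setT f ->
  measurable_fun setT (heat_semigroup t f).
Proof.
move=> mf.
exact: (measurableT_comp (measurable_fun_heat_semigroup f mf) (pair1_measurable t)).
Qed.

(** Jensen: [(f - m) ^ 2] has a nonnegative average for [m] the average of [f]. *)
Lemma heat_semigroup_jensen t x f : 0 < t -> square_integrable f ->
  ((heat_semigroup t f x ^+ 2)%:E <= \int[leb]_y (K t x y * f y ^+ 2)%:E)%E.
Proof.
move=> t0 f2; set m := heat_semigroup t f x.
have iK := integrable_heat_kernel t x t0.
have iKf := integrable_heat_kernel_mul t x f t0 f2.
have iKf2 := integrable_heat_kernel_sqr t x f t0 f2.
have : (\int[leb]_y ((2 * m)%:E * (K t x y * f y)%:E) <=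
    \int[leb]_y ((K t x y * f y ^+ 2)%:E + (m ^+ 2)%:E * (K t x y)%:E))%E.
  apply: le_integral => //; first exact: integrableZl.
    by apply: integrableD => //; exact: integrableZl.
  move=> y _; rewrite -!EFinM -EFinD lee_fin -subr_ge0.
  rewrite (_ : _ - _ = K t x y * (f y - m) ^+ 2); last by ring.
  by rewrite mulr_ge0 ?heat_kernel_ge0 ?sqr_ge0.
rewrite integralZl// integralD//; last exact: integrableZl.
rewrite (integralZl _ iK)// -(heat_semigroupE t x f)// -/m.
under [X in (_ <= _ + _ * X)%E]eq_integral do rewrite heat_kernelC.
rewrite integral_heat_kernel// mule1 -EFinM.
have := integrable_fin_num measurableT iKf2.
by case: (\int[leb]_y _)%E => // r _; rewrite -EFinD !lee_fin; lra.
Qed.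

(** The kernel being symmetric, weighting the evolved function by [phi] amounts to
    weighting the initial one by the evolution of [phi]. *)
Lemma integral_heat_semigroup_sqr_le t f (phi theta : E -> R) :
  0 < t -> square_integrable f ->
  measurable_fun setT phi -> (forall x, 0 <= phi x) -> measurable_fun setT theta ->
  (forall y, (\int[leb]_x (K t x y * phi x)%:E <= (theta y)%:E)%E) ->
  (\int[leb]_x (phi x * heat_semigroup t f x ^+ 2)%:E <=
    \int[leb]_y (theta y * f y ^+ 2)%:E)%E.
Proof.
move=> t0 f2 mphi phi0 mtheta phi_theta; have [mf _] := f2.
pose F (w : E * E) := (phi w.1 * (K t w.1 w.2 * f w.2 ^+ 2))%:E.
have mF : measurable_fun setT F.
  apply/measurable_EFinP; apply: measurable_funM.
    by apply: measurableT_comp => //; exact: measurable_fst.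
  apply: measurable_funM.
    exact: measurable_heat_kernel.
  by apply: measurable_funX; apply: measurableT_comp => //; exact: measurable_snd.
have F0 w : (0 <= F w)%E.
  by rewrite lee_fin mulr_ge0// mulr_ge0 ?heat_kernel_ge0 ?sqr_ge0.
have mKf2 x : measurable_fun setT (fun y => (K t x y * f y ^+ 2)%:E).
  exact: measurable_int (integrable_heat_kernel_sqr t x f t0 f2).
apply: (@le_trans _ _ (\int[leb]_x \int[leb]_y F (x, y))%E).
  apply: ge0_le_integral => //.
  - by move=> x _; rewrite lee_fin mulr_ge0 ?sqr_ge0.
  - apply/measurable_EFinP; apply: measurable_funM => //; apply: measurable_funX.
    exact: measurable_heat_semigroup.
  - exact: measurable_fun_fubini_tonelli_F.
  move=> x _; rewrite /F/=; under eq_integral do rewrite EFinM.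
  rewrite ge0_integralZl_EFin//; last first.
    by move=> y _; rewrite lee_fin mulr_ge0 ?heat_kernel_ge0 ?sqr_ge0.
  by rewrite EFinM lee_wpmul2l ?lee_fin// heat_semigroup_jensen.
rewrite fubini_tonelli//; apply: ge0_le_integral => //.
- by move=> y _; exact: integral_ge0.
- exact: measurable_fun_fubini_tonelli_G.
- apply/measurable_EFinP; apply: measurable_funM => //; exact: measurable_funX.
move=> y _; rewrite /F/=.
under eq_integral do rewrite mulrCA mulrA mulrC EFinM.
rewrite ge0_integralZl_EFin ?sqr_ge0//; last 2 first.
- by move=> x _; rewrite lee_fin mulr_ge0 ?heat_kernel_ge0.
- apply/measurable_EFinP; apply: measurable_funM => //.
  exact: (measurable_heat_kernel t id (cst y)).
rewrite [theta y * _]mulrC [leRHS]EFinM; apply: lee_wpmul2l => //.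
by rewrite lee_fin sqr_ge0.
Qed.

Lemma integral_heat_semigroup_sqr_contraction t f : 0 < t -> square_integrable f ->
  (\int[leb]_x (heat_semigroup t f x ^+ 2)%:E <= \int[leb]_y (f y ^+ 2)%:E)%E.
Proof.
move=> t0 f2.
have le1 : (\int[leb]_x (1 * heat_semigroup t f x ^+ 2)%:E <=
    \int[leb]_y (1 * f y ^+ 2)%:E)%E.
  apply: (integral_heat_semigroup_sqr_le t f (cst 1) (cst 1)) => // y.
  by under eq_integral do rewrite mulr1; rewrite integral_heat_kernel.
by apply: le_trans (le_trans _ le1) _; rewrite le_eqVlt; apply/orP; left; apply/eqP;
  apply: eq_integral => x _; rewrite mul1r.
Qed.

Lemma square_integrable_heat_semigroup t f : square_integrable f ->
  square_integrable (heat_semigroup t f).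
Proof.
move=> f2; have [mf if2] := f2; split; first exact: measurable_heat_semigroup.
have [t0|t0] := boolP (0 < t); last by rewrite /heat_semigroup (negbTE t0).
apply/integrableP; split.
  by apply/measurable_EFinP; apply: measurable_funX; exact: measurable_heat_semigroup.
under eq_integral => x _ do rewrite gee0_abs ?lee_fin ?sqr_ge0//.
apply: le_lt_trans (integral_heat_semigroup_sqr_contraction t f t0 f2) _.
by rewrite -ge0_fin_numE ?integral_ge0 ?integrable_fin_num// => y _; rewrite lee_fin sqr_ge0.
Qed.

(** Fubini and the Chapman-Kolmogorov identity; the absolute integrand is summable
    because integrating out the middle point first leaves [K (s + t) x y * |f y|]. *)
Lemma heat_semigroupD s t f x : 0 <= s -> 0 < t -> square_integrable f ->
  heat_semigroup (s + t) f x = heat_semigroup t (heat_semigroup s f) x.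
Proof.
rewrite le_eqVlt => /predU1P[<-|s0] t0 f2.
  by rewrite add0r; congr heat_semigroup; apply/funext => y; rewrite /heat_semigroup ltxx.
have st0 : 0 < s + t by rewrite addr_gt0.
have [mf _] := f2; apply: EFin_inj.
rewrite heat_semigroupE// heat_semigroupE//; last exact: square_integrable_heat_semigroup.
pose F (w : E * E) := (K t x w.1 * (K s w.1 w.2 * f w.2))%:E.
have mK (g h : E * E -> E) r : 0 < r -> measurable_fun setT g -> measurable_fun setT h ->
    measurable_fun setT (fun w => K r (g w) (h w)).
  exact: measurable_heat_kernel.
have mF : measurable_fun setT F.
  apply/measurable_EFinP; apply: measurable_funM.
    exact: (mK (cst x) fst).
  apply: measurable_funM; last by apply: measurableT_comp => //; exact: measurable_snd.
  exact: mK.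
have integral_K g y : (\int[leb]_z (g * (K t x z * K s z y))%:E = (g * K (s + t) x y)%:E)%E.
  rewrite EFinM -heat_kernel_chapman_kolmogorov//.
  rewrite -integralZl//.
  apply/integrableP; split.
    apply/measurable_EFinP; apply: measurable_funM.
      exact: measurable_heat_kernel1.
    exact: (measurable_heat_kernel s id (cst y)).
  rewrite (_ : (\int[_]_z _)%E = (\int[leb]_z (K t x z * K s z y)%:E)%E).
    by rewrite heat_kernel_chapman_kolmogorov// ltry.
  by apply: eq_integral => z _; rewrite gee0_abs// lee_fin mulr_ge0 ?heat_kernel_ge0.
have iF : (leb \x leb)%E.-integrable setT F.
  apply/(integrable21ltyP _ _ mF).
  rewrite (_ : (\int[leb]_y _)%E = (\int[leb]_y `|(K (s + t) x y * f y)%:E|)%E).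
    by have /integrableP[] := integrable_heat_kernel_mul _ x f st0 f2.
  apply: eq_integral => y _; rewrite abse_EFin normrM mulrC.
  rewrite (ger0_norm (heat_kernel_ge0 _ _)) -integral_K; apply: eq_integral => z _.
  rewrite /F/= mulrA normrM mulrC.
  by rewrite (ger0_norm (mulr_ge0 (heat_kernel_ge0 _ _) (heat_kernel_ge0 _ _))).
transitivity (\int[leb]_z \int[leb]_y F (z, y))%E.
  rewrite (Fubini iF); apply: eq_integral => y _; rewrite mulrC -integral_K.
  by apply: eq_integral => z _; rewrite /F/=; congr EFin; ring.
apply: eq_integral => z _; rewrite /F/= EFinM heat_semigroupE//.
under eq_integral do rewrite EFinM.
by rewrite integralZl//; exact: integrable_heat_kernel_mul.
Qed.

End Semigroup.

(** * The cutoff *)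

Section Cutoff.
Context {R : realType} {n : nat}.
Local Notation E := (euclid R n).
Local Notation leb := (leb R n).
Implicit Types (h : R) (x y p : E).
Local Notation K t x y := (heat_kernel t (euclid_sub x y)).

Definition enorm x : R := Num.sqrt (sqnorm x).

Lemma enorm_ge0 x : 0 <= enorm x. Proof. exact: sqrtr_ge0. Qed.

Lemma enorm_sqr x : enorm x ^+ 2 = sqnorm x.
Proof. by rewrite sqr_sqrtr// sqnorm_ge0. Qed.

(** Cauchy-Schwarz, from the nonnegativity of [|(|y| ^ 2) x - S y| ^ 2]. *)
Lemma dot_le_enorm x y :
  \sum_(i < n) (tnth x i : R) * tnth y i <= enorm x * enorm y.
Proof.
set S := \sum_(i < n) _.
have S2 : S ^+ 2 <= sqnorm x * sqnorm y.
  have [y0|y_neq0] := eqVneq (sqnorm y) 0.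
    have yi0 i : (tnth y i : R) = 0.
      move/eqP: y0; rewrite psumr_eq0; last by move=> j _; exact: sqr_ge0.
      by move=> /allP/(_ i (mem_index_enum i))/=; rewrite sqrf_eq0 => /eqP.
    rewrite y0 mulr0 /S big1 ?expr0n// => i _.
    by rewrite yi0 mulr0.
  have y_gt0 : 0 < sqnorm y by rewrite lt_def y_neq0 sqnorm_ge0.
  rewrite -subr_ge0 -(pmulr_rge0 _ y_gt0).
  rewrite [X in 0 <= X](_ : _ =
    \sum_(i < n) (sqnorm y * (tnth x i : R) - S * tnth y i) ^+ 2); last first.
    transitivity (sqnorm y ^+ 2 * sqnorm x - 2 * sqnorm y * S * S +
      S ^+ 2 * sqnorm y); first by ring.
    rewrite [in RHS](eq_bigr (fun i => sqnorm y ^+ 2 * (tnth x i : R) ^+ 2 -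
      2 * sqnorm y * S * ((tnth x i : R) * tnth y i) +
      S ^+ 2 * (tnth y i : R) ^+ 2)); last by move=> i _; ring.
    by rewrite big_split/= sumrB -!mulr_sumr.
  by apply: sumr_ge0 => i _; exact: sqr_ge0.
apply: le_trans (ler_norm _) _.
by rewrite -sqrtr_sqr /enorm -sqrtrM ?sqnorm_ge0// ler_wsqrtr.
Qed.

Lemma enorm_triangle x y : enorm x <= enorm y + enorm (euclid_sub x y).
Proof.
rewrite -ler_sqr ?nnegrE ?addr_ge0 ?enorm_ge0// sqrrD.
set d := euclid_sub x y.
have xE : sqnorm x = sqnorm y + 2 * (\sum_(i < n) (tnth y i : R) * tnth d i) + sqnorm d.
  rewrite /sqnorm mulr_sumr -!big_split/=; apply: eq_bigr => i _.
  by rewrite tnth_mktuple; ring.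
rewrite !enorm_sqr xE; have := dot_le_enorm y d.
by rewrite -mulr_natl; lra.
Qed.

Lemma enorm_subC x y : enorm (euclid_sub x y) = enorm (euclid_sub y x).
Proof. by rewrite /enorm sqnorm_subC. Qed.

Lemma measurable_sqnorm : measurable_fun setT (@sqnorm R n).
Proof.
by apply: measurable_sum => i; apply: measurable_funX; exact: measurable_tnth_comp.
Qed.

Lemma measurable_enorm : measurable_fun setT enorm.
Proof.
have -> : enorm = (fun s => s `^ 2^-1) \o @sqnorm R n.
  by apply/funext => x; rewrite /= powR12_sqrt ?sqnorm_ge0.
by apply: measurableT_comp => //; exact: measurable_sqnorm.
Qed.

Lemma measurable_eball r : measurable (eball n r : set E).
Proof.
rewrite [X in measurable X](_ : _ = enorm @^-1` `]-oo, r[%classic).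
  by rewrite -[X in measurable X]setTI; apply: measurable_enorm.
by apply/seteqP; split => x; rewrite /eball/= in_itv.
Qed.

(** The squared distance to the complement of the ball of radius [b], rescaled to
    reach 1 on the ball of radius [a] and capped there.  As a minimum of paraboloids
    it is semiconcave, which is all the regularity that Gaussian averaging needs. *)
Definition cutoff (a b : R) x : R :=
  Num.min 1 ((b - a) ^- 2 * Num.max 0 (b - enorm x) ^+ 2).

Variables (a b : R).
Hypotheses (a0 : 0 < a) (ab : a < b).
Local Notation psi := (cutoff a b).

Let ba0 : 0 < b - a. Proof. by rewrite subr_gt0. Qed.
Let scale0 : 0 < (b - a) ^- 2. Proof. by rewrite invr_gt0 exprn_gt0. Qed.

Lemma measurable_cutoff : measurable_fun setT psi.
Proof.
apply: measurable_minr => //; apply: measurable_funM => //.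
apply: measurable_funX; apply: measurable_maxr => //.
by apply: measurable_funB => //; exact: measurable_enorm.
Qed.

Lemma cutoff_ge0 x : 0 <= psi x.
Proof. by rewrite le_min ler01 mulr_ge0 ?sqr_ge0 ?(ltW scale0). Qed.

Lemma cutoff_le1 x : psi x <= 1.
Proof. by rewrite ge_min lexx. Qed.

Lemma cutoff_eq1 x : enorm x < a -> psi x = 1.
Proof.
move=> xa; apply/min_idPl; rewrite mulrC lter_pdivlMr ?exprn_gt0// mul1r.
by rewrite ler_sqr ?nnegrE ?le_max ?lexx ?(ltW ba0)// lerD2l lerN2 (ltW xa) orbT.
Qed.

Lemma cutoff_eq0 x : b <= enorm x -> psi x = 0.
Proof.
move=> bx; rewrite /cutoff max_l ?subr_le0//.
by rewrite expr0n mulr0 min_r.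
Qed.

Lemma cutoff_le_dist x p : b <= enorm p ->
  psi x <= (b - a) ^- 2 * sqnorm (euclid_sub x p).
Proof.
move=> bp; rewrite ge_min ler_wpM2l ?orbT ?(ltW scale0)// -enorm_sqr.
rewrite ler_sqr ?nnegrE ?enorm_ge0 ?le_max ?lexx// ge_max enorm_ge0 lerBlDl.
by rewrite enorm_subC (le_trans bp)// enorm_triangle.
Qed.

(** The touching paraboloid at [y] is centred at the point of the complement of the
    ball nearest to [y]: the radial projection of [y], or [y] itself if it is outside. *)
Lemma cutoff_attained y : psi y < 1 -> exists2 p, b <= enorm p &
  psi y = (b - a) ^- 2 * sqnorm (euclid_sub y p).
Proof.
move=> y1.
have psiE : psi y = (b - a) ^- 2 * Num.max 0 (b - enorm y) ^+ 2.
  by move: y1; rewrite gt_min ltxx/= => v1; rewrite /cutoff min_r// ltW.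
have [yb|yb] := leP b (enorm y).
  exists y => //; rewrite cutoff_eq0// sqnorm_sub big1 ?mulr0// => i _.
  by rewrite subrr expr0n.
have y0 : 0 < enorm y.
  apply: lt_le_trans a0 _; rewrite leNgt; apply/negP => ya.
  by move: y1; rewrite cutoff_eq1// ltxx.
pose p : E := [tuple b / enorm y * (tnth y i : R) | i < n].
exists p.
  have -> : enorm p = b; last by [].
  rewrite /enorm (_ : sqnorm p = b ^+ 2).
    by rewrite sqrtr_sqr gtr0_norm// (lt_trans a0).
  rewrite /sqnorm; under eq_bigr do rewrite tnth_mktuple exprMn.
  by rewrite -mulr_sumr -[X in _ * X]enorm_sqr -exprMn divfK// gt_eqF.
rewrite psiE max_r ?subr_ge0 ?(ltW yb)//; congr (_ * _).
rewrite sqnorm_sub; under eq_bigr do rewrite tnth_mktuple -[X in X - _]mul1r -mulrBl exprMn.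
rewrite -mulr_sumr -[X in _ * X]enorm_sqr -exprMn mulrBl divfK ?gt_eqF// mul1r.
by rewrite -sqrrN opprB.
Qed.

Let integral_kernel_cutoff_le1 h y : 0 < h ->
  (\int[leb]_x (K h x y * psi x)%:E <= 1)%E.
Proof.
move=> h0; rewrite -(integral_heat_kernel h y h0); apply: ge0_le_integral => //.
- by move=> x _; rewrite lee_fin mulr_ge0 ?heat_kernel_ge0 ?cutoff_ge0.
- apply/measurable_EFinP; apply: measurable_funM; last exact: measurable_cutoff.
  exact: (measurable_heat_kernel h id (cst y)).
- by apply/measurable_EFinP; exact: (measurable_heat_kernel h id (cst y)).
- by move=> x _; rewrite lee_fin ler_piMr ?heat_kernel_ge0 ?cutoff_le1.
Qed.

Let integral_kernel_cutoff_le h y (c d : R) (q : E -> R) : 0 < h -> 0 <= c ->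
  measurable_fun setT q -> (forall x, 0 <= q x) -> (forall x, psi x <= c * q x) ->
  (\int[leb]_x (K h x y * q x)%:E <= d%:E)%E ->
  (\int[leb]_x (K h x y * psi x)%:E <= (c * d)%:E)%E.
Proof.
move=> h0 c0 mq q0 psiq qd.
have mK : measurable_fun setT (fun x => K h x y).
  exact: (measurable_heat_kernel h id (cst y)).
apply: (@le_trans _ _ (\int[leb]_x (c%:E * (K h x y * q x)%:E))%E).
  apply: ge0_le_integral => //.
  - by move=> x _; rewrite lee_fin mulr_ge0 ?heat_kernel_ge0 ?cutoff_ge0.
  - apply/measurable_EFinP; apply: measurable_funM => //; exact: measurable_cutoff.
  - by apply/measurable_EFinP; apply: measurable_funM => //; exact: measurable_funM.
  - by move=> x _; rewrite -EFinM lee_fin mulrCA ler_wpM2l ?heat_kernel_ge0.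
rewrite ge0_integralZl_EFin//.
- by rewrite EFinM lee_wpmul2l ?lee_fin.
- by move=> x _; rewrite lee_fin mulr_ge0 ?heat_kernel_ge0.
- by apply/measurable_EFinP; exact: measurable_funM.
Qed.

Let measurable_sqnorm_sub p : measurable_fun setT (fun x => sqnorm (euclid_sub x p)).
Proof.
under eq_fun do rewrite sqnorm_sub.
apply: measurable_sum => i; apply: measurable_funX.
by apply: measurable_funB => //; exact: measurable_tnth_comp.
Qed.

(** At each [y] the cutoff touches from below either the constant 1 or a paraboloid
    [(b - a) ^- 2 * |x - p| ^ 2], and the averages of both are controlled. *)
Lemma integral_kernel_cutoff h y : 0 < h ->
  (\int[leb]_x (K h x y * psi x)%:E <=
    (psi y + 16 * n%:R * (b - a) ^- 2 * h)%:E)%E.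
Proof.
move=> h0; have [y1|] := ltP (psi y) 1; last first.
  move=> y1; apply: le_trans (integral_kernel_cutoff_le1 h y h0) _.
  rewrite lee_fin (le_trans y1)// lerDl.
  by rewrite !mulr_ge0 ?ler0n ?(ltW scale0) ?(ltW h0).
have [p bp ->] := cutoff_attained y y1.
rewrite (_ : _ + _ = (b - a) ^- 2 * (sqnorm (euclid_sub y p) + 16 * n%:R * h)).
  apply: (integral_kernel_cutoff_le h y _ _ (fun x => sqnorm (euclid_sub x p))) => //.
  - exact: ltW.
  - by move=> x; exact: sqnorm_ge0.
  - by move=> x; exact: cutoff_le_dist.
  - exact: integral_heat_kernel_sqr.
by ring.
Qed.

(** Away from the support the average of the cutoff is a Gaussian tail.  The fourth
    moment makes it [o (h)]; the second would only give a term of the order of the main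
    one, which is affordable inside the ball of radius [r] alone. *)
Lemma integral_kernel_cutoff_far h y r : 0 < h -> b < r -> r <= enorm y ->
  (\int[leb]_x (K h x y * psi x)%:E <=
    (384 * n%:R ^+ 2 * (r - b) ^- 4 * h ^+ 2)%:E)%E.
Proof.
move=> h0 br ry; have d0 : 0 < r - b by rewrite subr_gt0.
rewrite (_ : _ * h ^+ 2 = (r - b) ^- 4 * (384 * n%:R ^+ 2 * h ^+ 2)); last by ring.
apply: (integral_kernel_cutoff_le h y _ _ (fun x => sqnorm (euclid_sub x y) ^+ 2)) => //.
- by rewrite invr_ge0 exprn_ge0// ltW.
- exact: measurable_funX.
- by move=> x; exact: sqr_ge0.
- move=> x; have [bx|xb] := leP b (enorm x).
    by rewrite cutoff_eq0// mulr_ge0 ?sqr_ge0// invr_ge0 exprn_ge0// ltW.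
  apply: le_trans (cutoff_le1 x) _.
  rewrite mulrC ler_pdivlMr ?exprn_gt0// mul1r -enorm_sqr -exprM.
  rewrite lerXn2r ?nnegrE ?enorm_ge0 ?(ltW d0)//.
  by have := enorm_triangle y x; rewrite enorm_subC; lra.
- exact: integral_heat_kernel_fourth.
Qed.

Lemma integral_kernel_cutoff_ball h y r : 0 < h -> b < r ->
  (\int[leb]_x (K h x y * psi x)%:E <=
    (psi y + 16 * n%:R * (b - a) ^- 2 * h * \1_(eball n r) y +
     384 * n%:R ^+ 2 * (r - b) ^- 4 * h ^+ 2)%:E)%E.
Proof.
move=> h0 br; rewrite indicE; case: (boolP (y \in _)) => [_|].
  apply: le_trans (integral_kernel_cutoff h y h0) _.
  rewrite lee_fin mulr1 lerDl !mulr_ge0 ?ler0n ?exprn_ge0 ?(ltW h0)//.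
  by rewrite invr_ge0 exprn_ge0// subr_ge0 ltW.
rewrite notin_setE /eball/= => /negP; rewrite -leNgt => ry.
apply: le_trans (integral_kernel_cutoff_far h y r h0 br ry) _.
by rewrite lee_fin mulr0 addr0 lerDr cutoff_ge0.
Qed.

End Cutoff.

(** * From one-step growth bounds to time averages *)

Section TimeAverage.
Context {R : realType}.
Local Notation mu := (@lebesgue_measure R).

Lemma ge0_integral_itv_split (ba bb bc : itv_bound R) (f : R -> \bar R) :
  (ba <= bb)%O -> (bb <= bc)%O -> measurable_fun [set` Interval ba bc] f ->
  (forall x, x \in Interval ba bc -> (0 <= f x)%E) ->
  (\int[mu]_(x in [set` Interval ba bc]) f x =
   \int[mu]_(x in [set` Interval ba bb]) f x +
   \int[mu]_(x in [set` Interval bb bc]) f x)%E.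
Proof.
move=> ab bc_ mf f0; rewrite (itv_bndbnd_setU ab bc_) ge0_integral_setU//.
- by rewrite -(itv_bndbnd_setU ab bc_).
- by move=> x; rewrite -(itv_bndbnd_setU ab bc_); exact: f0.
- apply/disj_setPS => x [/=]; rewrite !itv_boundlr => /andP[_ xb] /andP[bx _].
  by have := le_trans xb bx; rewrite bnd_simp ltxx.
Qed.

Variables (g v : R -> R) (A a D T : R).
Hypotheses (mg : measurable_fun setT g) (mv : measurable_fun setT v).
Hypotheses (g0 : forall t, 0 <= g t) (gv : forall t, g t <= v t)
  (vA : forall t, v t <= A).
Hypotheses (a0 : 0 <= a) (D0 : 0 <= D) (T0 : 0 < T).
Hypothesis step : forall t h, 0 <= t -> 0 < h ->
  g (t + h) <= g t + a * h * v t + D * h ^+ 2.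

Let v0 t : 0 <= v t. Proof. exact: le_trans (g0 t) (gv t). Qed.
Let A0 : 0 <= A. Proof. exact: le_trans (v0 0) (vA 0). Qed.

(** The weight [t] vanishes at time 0, where nothing bounds [g] in terms of [v]
    averaged over [0, T]. *)
Let H t := t * g t.
Let k := 1 + T * a.
Let D' := a * A + 2 * T * D.

Let k_ge0 : 0 <= k. Proof. by rewrite addr_ge0// mulr_ge0// ltW. Qed.
Let D'_ge0 : 0 <= D'.
Proof. by rewrite addr_ge0 ?mulr_ge0 ?(ltW T0). Qed.

Let weighted_step t h : 0 <= t -> 0 < h -> t + h <= T ->
  H (t + h) <= H t + h * k * v t + D' * h ^+ 2.
Proof.
move=> t0 h0 thT.
have hT : h <= T by lra.
have tT : t <= T by lra.
have st := step t h t0 h0.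
have -> : H (t + h) = t * g (t + h) + h * g (t + h) by rewrite /H; ring.
have le1 : t * g (t + h) <= t * (g t + a * h * v t + D * h ^+ 2) by exact: ler_wpM2l.
have le2 : h * g (t + h) <= h * (g t + a * h * v t + D * h ^+ 2).
  by rewrite ler_wpM2l// ltW.
have hv : 0 <= h * v t by rewrite mulr_ge0// ltW.
have le3 : t * (a * h * v t) <= T * (a * h * v t).
  by rewrite ler_wpM2r// -mulrA mulr_ge0.
have le4 : t * (D * h ^+ 2) <= T * (D * h ^+ 2).
  by rewrite ler_wpM2r// mulr_ge0 ?sqr_ge0.
have le5 : h * (D * h ^+ 2) <= T * (D * h ^+ 2).
  by rewrite ler_wpM2r// mulr_ge0 ?sqr_ge0.
have le6 : a * h ^+ 2 * v t <= a * h ^+ 2 * A.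
  by rewrite ler_wpM2l// mulr_ge0 ?sqr_ge0.
have le7 : h * g t <= h * v t by rewrite ler_wpM2l// ltW.
apply: le_trans (lerD le1 le2) _.
rewrite /H /k /D'.
have -> : h * (g t + a * h * v t + D * h ^+ 2) =
  h * g t + a * h ^+ 2 * v t + h * (D * h ^+ 2) by ring.
have -> : t * (g t + a * h * v t + D * h ^+ 2) =
  t * g t + t * (a * h * v t) + t * (D * h ^+ 2) by ring.
have -> : h * (1 + T * a) * v t = h * v t + T * (a * h * v t) by ring.
have -> : (a * A + 2 * T * D) * h ^+ 2 =
  a * h ^+ 2 * A + T * (D * h ^+ 2) + T * (D * h ^+ 2) by ring.
lra.
Qed.

Let mH (B : set R) : measurable B -> measurable_fun B (fun t => (H t)%:E).
Proof.
move=> mB; apply: measurable_funTS; apply/measurable_EFinP.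
exact: measurable_funM.
Qed.

Let V := fine (\int[mu]_(t in `[0%R, T]) (v t)%:E).

Let VE : (\int[mu]_(t in `[0%R, T]) (v t)%:E = V%:E)%E.
Proof.
rewrite fineK// ge0_fin_numE; last first.
  by apply: integral_ge0 => t _; rewrite lee_fin.
apply: (@le_lt_trans _ _ (\int[mu]_(t in `[0%R, T]) A%:E)%E).
  apply: ge0_le_integral => //.
  - by move=> t _; rewrite lee_fin.
  - by apply: measurable_funTS; exact/measurable_EFinP.
  - by move=> t _; rewrite lee_fin.
rewrite integral_cst//= lebesgue_measure_itv/= lte_fin T0 -EFinB -EFinM.
exact: ltry.
Qed.

Let integral_H_le (B : set R) (c : R) : measurable B ->
  (forall t, B t -> 0 <= t /\ H t <= c) ->
  (\int[mu]_(t in B) (H t)%:E <= c%:E * mu B)%E.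
Proof.
move=> mB Bc; rewrite -integral_cst//; apply: ge0_le_integral => //.
- by move=> t /Bc[t0 _]; rewrite lee_fin mulr_ge0.
- exact: mH.
- by move=> t /Bc[_ Hc]; rewrite lee_fin.
Qed.

Let H_le t : 0 <= t -> t <= T -> H t <= t * A.
Proof. by move=> t0 _; rewrite ler_wpM2l// (le_trans (gv t)). Qed.

(** The one-step bound, read backwards from [T], keeps [H] from being much smaller
    than [H T] just before [T]. *)
Let late h : 0 < h -> 2 * h < T ->
  ((h * (H T - h * (k * A + D' * T)))%:E <=
    \int[mu]_(t in `](T - h)%R, T]) (H t)%:E)%E.
Proof.
move=> h0 hT; set c := H T - _.
have [c0|c0] := leP c 0.
  apply: (@le_trans _ _ 0%E); first by rewrite lee_fin pmulr_rle0.
  apply: integral_ge0 => t /=; rewrite in_itv/= => /andP[t1 _].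
  by rewrite lee_fin mulr_ge0//; lra.
rewrite (_ : (h * c)%:E = (\int[mu]_(t in `](T - h)%R, T]) c%:E)%E); last first.
  rewrite integral_cst//= lebesgue_measure_itv/= lte_fin ltrBlDr ltrDl h0.
  by rewrite -EFinB -EFinM; congr EFin; ring.
apply: ge0_le_integral => //.
- by move=> t _; rewrite lee_fin ltW.
- exact: mH.
move=> t /=; rewrite in_itv/= => /andP[t1 tT]; rewrite lee_fin /c lerBlDr.
have kA : 0 <= k * A by rewrite mulr_ge0.
move: tT; rewrite le_eqVlt => /predU1P[->|tT].
  by rewrite lerDl mulr_ge0 ?(ltW h0)// addr_ge0 ?mulr_ge0// ltW.
have := weighted_step t (T - t); rewrite (_ : t + (T - t) = T); last by ring.
move=> st.
apply: le_trans (st _ _ _) _; [lra|lra|lra|].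
have : (T - t) * k * v t <= h * (k * A).
  rewrite -mulrA ler_pM ?mulr_ge0//; [lra|lra|exact: ler_wpM2l].
have : D' * (T - t) ^+ 2 <= h * (D' * T).
  by rewrite expr2 mulrCA ler_pM ?mulr_ge0 ?ler_wpM2l//; lra.
lra.
Qed.

Let approx h : 0 < h -> 2 * h < T ->
  H T <= k * V + h * (k * A + 2 * D' * T + A).
Proof.
move=> h0 hT.
have mS (i : interval R) : measurable_fun [set` i] (fun t => (H (h + t))%:E).
  apply: measurable_funTS; apply/measurable_EFinP; apply: measurable_funM.
    exact: measurable_funD.
  by apply: measurableT_comp => //; exact: measurable_funD.
have mW (i : interval R) :
    measurable_fun [set` i] (fun t => (h * k * v t + D' * h ^+ 2)%:E).
  apply: measurable_funTS; apply/measurable_EFinP; apply: measurable_funD => //.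
  exact: measurable_funM.
have W0 t : 0 <= h * k * v t + D' * h ^+ 2.
  by rewrite addr_ge0 ?mulr_ge0 ?sqr_ge0 ?(ltW h0).
set F := (\int[mu]_(t in `[0%R, h[) (H t)%:E)%E.
set J := (\int[mu]_(t in `[h, (T - h)%R]) (H t)%:E)%E.
set L := (\int[mu]_(t in `](T - h)%R, T]) (H t)%:E)%E.
have JL : (\int[mu]_(t in `[h, T]) (H t)%:E = J + L)%E.
  apply: ge0_integral_itv_split; rewrite ?bnd_simp; [lra|lra|exact: mH|].
  by move=> t; rewrite in_itv/= => /andP[t1 _]; rewrite lee_fin mulr_ge0//; lra.
have FJ : (\int[mu]_(t in `[0%R, (T - h)%R]) (H t)%:E = F + J)%E.
  apply: ge0_integral_itv_split; rewrite ?bnd_simp; [lra|lra|exact: mH|].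
  by move=> t; rewrite in_itv/= => /andP[t1 _]; rewrite lee_fin mulr_ge0.
have shifted : (\int[mu]_(t in `[h, T]) (H t)%:E =
    \int[mu]_(t in `[0%R, (T - h)%R]) (H (h + t))%:E)%E.
  rewrite -(ge0_integral_shift h)//.
  - congr integral; apply/seteqP; split => t /=; rewrite !in_itv/=; lra.
  - exact: mH.
  - by move=> t /=; rewrite in_itv/= => /andP[t1 _]; rewrite lee_fin mulr_ge0//; lra.
have step_int : (J + L <= F + J + (h * k * V + D' * h ^+ 2 * T)%:E)%E.
  rewrite -JL -FJ shifted.
  apply: (@le_trans _ _ (\int[mu]_(t in `[0%R, (T - h)%R])
      ((H t)%:E + (h * k * v t + D' * h ^+ 2)%:E))%E).
    apply: ge0_le_integral => //.
    - by move=> t /=; rewrite in_itv/= => /andP[t1 _]; rewrite lee_fin mulr_ge0//; lra.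
    - exact: mS.
    - by apply: emeasurable_funD; [exact: mH|exact: mW].
    move=> t /=; rewrite in_itv/= => /andP[t1 t2]; rewrite -EFinD lee_fin addrA.
    by rewrite [h + t]addrC; apply: weighted_step => //; lra.
  rewrite ge0_integralD//; last 4 first.
  - by move=> t /=; rewrite in_itv/= => /andP[t1 _]; rewrite lee_fin mulr_ge0.
  - exact: mH.
  - by move=> t _; rewrite lee_fin W0.
  - exact: mW.
  rewrite leeD2l//.
  apply: (@le_trans _ _ (\int[mu]_(t in `[0%R, T])
      ((h * k)%:E * (v t)%:E + (D' * h ^+ 2)%:E))%E).
    apply: ge0_subset_integral => //; first exact: mW.
      by move=> t _; rewrite lee_fin W0.
    by move=> t /=; rewrite !in_itv/= => /andP[-> t2]/=; lra.
  have mvE : measurable_fun `[0%R, T] (fun t => (v t)%:E).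
    by apply: measurable_funTS; exact/measurable_EFinP.
  rewrite ge0_integralD//; last 3 first.
  - by move=> t _; rewrite lee_fin !mulr_ge0 ?(ltW h0).
  - exact: emeasurable_funM.
  - by move=> t _; rewrite lee_fin mulr_ge0 ?sqr_ge0.
  rewrite ge0_integralZl_EFin//; last 2 first.
  - by move=> t _; rewrite lee_fin.
  - by rewrite mulr_ge0// ltW.
  by rewrite VE integral_cst//= lebesgue_measure_itv/= lte_fin T0 sube0 -!EFinM -EFinD.
have J0 : (0 <= J)%E.
  apply: integral_ge0 => t /=; rewrite in_itv/= => /andP[t1 _].
  by rewrite lee_fin mulr_ge0//; lra.
have J_fin : (J < +oo)%E.
  apply: le_lt_trans (integral_H_le `[h, T - h]%classic (T * A) _ _) _ => //.
    move=> t /=; rewrite in_itv/= => /andP[t1 t2]; split; first lra.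
    by apply: le_trans (H_le t _ _) _; [lra|lra|rewrite ler_wpM2r//; lra].
  rewrite lebesgue_measure_itv/= lte_fin; case: ifP => _; last by rewrite mule0 ltry.
  by rewrite -EFinB -EFinM ltry.
have F_le : (F <= (h * (h * A))%:E)%E.
  apply: le_trans (integral_H_le `[0, h[%classic (h * A) _ _) _ => //.
    move=> t /=; rewrite in_itv/= => /andP[t1 t2]; split => //.
    by apply: le_trans (H_le t _ _) _ => //; [lra|rewrite ler_wpM2r// ltW].
  by rewrite lebesgue_measure_itv/= lte_fin h0 sube0 -EFinM lee_fin mulrC.
have : ((h * (H T - h * (k * A + D' * T)))%:E <=
    (h * (h * A))%:E + (h * k * V + D' * h ^+ 2 * T)%:E)%E.
  apply: le_trans (late h h0 hT) _; rewrite -/L.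
  apply: le_trans _ (leeD2r _ F_le).
  rewrite -(@leeD2lE _ J) ?ge0_fin_numE//.
  by rewrite [leRHS]addeCA [leRHS]addeA.
rewrite -EFinD lee_fin => le_all.
rewrite -(ler_pM2l h0); lra.
Qed.

(** Comparing the integrals of [H] over [h, T] and over [0, T - h] with the one-step
    bound, the common part cancels and leaves the averages of [H] near [T] and near 0;
    the former tends to [H T] and the latter to 0 with [h]. *)
Lemma time_average : ((g T)%:E <=
  (T^-1 + a)%:E * \int[mu]_(t in `[0%R, T]) (v t)%:E)%E.
Proof.
rewrite VE -EFinM lee_fin.
have HT : H T <= k * V.
  apply/ler_addgt0Pr => e e0.
  pose C := k * A + 2 * D' * T + A + 1.
  have kA : 0 <= k * A by rewrite mulr_ge0.
  have D'T : 0 <= D' * T by rewrite mulr_ge0// ltW.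
  have C0 : 0 < C by have := A0; rewrite /C; lra.
  pose h := Num.min (T / 3) (e / C).
  have h0 : 0 < h by rewrite lt_min !divr_gt0.
  have hT : h <= T / 3 by rewrite ge_min lexx.
  apply: le_trans (approx h h0 _) _; first by lra.
  have hC : h * C <= e by rewrite -ler_pdivlMr// ge_min lexx orbT.
  rewrite lerD2l; apply: le_trans hC; rewrite ler_wpM2l ?(ltW h0)//.
  by rewrite /C lerDl.
rewrite -(ler_pM2l T0) mulrA mulrDr divff ?gt_eqF//.
Qed.

End TimeAverage.

(** * The local upper bound *)

Section Weighted.
Context {R : realType} {n : nat}.
Local Notation E := (euclid R n).
Local Notation leb := (leb R n).
Local Notation mu := (@lebesgue_measure R).

Lemma square_integrable_heat_solution (u : R -> E -> R) :
  heat_solution u -> square_integrable (u 0).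
Proof.
move=> [u0 _]; split; last exact: Lfun2_integrable_sqr.
by move: u0; rewrite inE => /andP[]; rewrite inE.
Qed.

Variable f : E -> R.
Hypothesis f2 : square_integrable f.
Local Notation w t := (heat_semigroup t f).

Definition total_energy := fine (\int[leb]_x (f x ^+ 2)%:E).

Let total_energyE : (\int[leb]_x (f x ^+ 2)%:E = total_energy%:E)%E.
Proof. by have [_ if2] := f2; rewrite fineK// integrable_fin_num. Qed.

Lemma total_energy_ge0 : 0 <= total_energy.
Proof. by apply: fine_ge0; apply: integral_ge0 => x _; rewrite lee_fin sqr_ge0. Qed.

Lemma integral_sqr_le_total_energy t :
  (\int[leb]_x (w t x ^+ 2)%:E <= total_energy%:E)%E.
Proof.
rewrite -total_energyE; have [t0|t0] := boolP (0 < t).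
  exact: integral_heat_semigroup_sqr_contraction.
by rewrite /heat_semigroup (negbTE t0).
Qed.

(** A real number, so that energies at different times can be subtracted.  It is
    applied to the cutoff and to indicators of balls. *)
Definition energy (phi : E -> R) t : R :=
  fine (\int[leb]_x (phi x * w t x ^+ 2)%:E).

Definition weight (phi : E -> R) : Prop :=
  measurable_fun setT phi /\ forall x, 0 <= phi x <= 1.

Variable phi : E -> R.
Hypothesis wphi : weight phi.

Let weighted_ge0 (chi : E -> R) t x : weight chi -> 0 <= chi x * w t x ^+ 2.
Proof. by move=> [_ chi01]; have /andP[? _] := chi01 x; rewrite mulr_ge0 ?sqr_ge0. Qed.

Let measurable_sqr t : measurable_fun setT (fun x => w t x ^+ 2).
Proof.
by apply: measurable_funX; apply: measurable_heat_semigroup; case: f2.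
Qed.

Let measurable_weighted (chi : E -> R) t : weight chi ->
  measurable_fun setT (fun x => (chi x * w t x ^+ 2)%:E).
Proof. by move=> [mchi _]; apply/measurable_EFinP; exact: measurable_funM. Qed.

Let weighted_le (chi : E -> R) t : weight chi ->
  (\int[leb]_x (chi x * w t x ^+ 2)%:E <= total_energy%:E)%E.
Proof.
move=> wchi; apply: le_trans (integral_sqr_le_total_energy t).
apply: ge0_le_integral => //.
- by move=> x _; rewrite lee_fin weighted_ge0.
- exact: measurable_weighted.
- exact/measurable_EFinP.
- move=> x _; rewrite lee_fin ler_piMl ?sqr_ge0//.
  by have [_ /(_ x)/andP[]] := wchi.
Qed.

Lemma energyE t : (\int[leb]_x (phi x * w t x ^+ 2)%:E = (energy phi t)%:E)%E.
Proof.
rewrite fineK// ge0_fin_numE.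
  by apply: le_lt_trans (weighted_le phi t wphi) _; rewrite ltry.
by apply: integral_ge0 => x _; rewrite lee_fin weighted_ge0.
Qed.

Lemma energy_ge0 t : 0 <= energy phi t.
Proof.
by apply: fine_ge0; apply: integral_ge0 => x _; rewrite lee_fin weighted_ge0.
Qed.

Lemma energy_le_total t : energy phi t <= total_energy.
Proof. by rewrite -lee_fin -energyE weighted_le. Qed.

Lemma measurable_energy : measurable_fun setT (energy phi).
Proof.
pose F (z : measurableTypeR R * E) := (phi z.2 * w z.1 z.2 ^+ 2)%:E.
apply: (measurableT_comp (fine_measurable measurableT)) => /=.
apply: (measurable_fun_fubini_tonelli_F F).
  apply/measurable_EFinP; apply: measurable_funM.
    by apply: measurableT_comp; [case: wphi|exact: measurable_snd].
  by apply: measurable_funX; apply: measurable_fun_heat_semigroup; case: f2.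
by move=> z; rewrite lee_fin weighted_ge0.
Qed.

End Weighted.
Arguments energy {R n}.
Arguments total_energy {R n}.

Section UpperBound.
Context {R : realType} {n : nat}.
Local Notation E := (euclid R n).
Local Notation leb := (leb R n).
Local Notation mu := (@lebesgue_measure R).

Lemma energy_le (f phi psi : E -> R) t : square_integrable f ->
  weight phi -> weight psi -> (forall x, phi x <= psi x) ->
  energy f phi t <= energy f psi t.
Proof.
move=> f2 wphi wpsi phipsi; rewrite -lee_fin -!energyE//.
have msqr : measurable_fun setT (fun x => heat_semigroup t f x ^+ 2).
  by apply: measurable_funX; apply: measurable_heat_semigroup; case: f2.
apply: ge0_le_integral => //.
- move=> x _; have [_ /(_ x)/andP[? _]] := wphi.
  by rewrite lee_fin mulr_ge0 ?sqr_ge0.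
- by apply/measurable_EFinP; apply: measurable_funM => //; case: wphi.
- by apply/measurable_EFinP; apply: measurable_funM => //; case: wpsi.
- by move=> x _; rewrite lee_fin ler_wpM2r ?sqr_ge0.
Qed.

Lemma weight_indic (B : set E) : measurable B -> weight (\1_B : E -> R).
Proof.
split; first exact: measurable_indic.
by move=> x; rewrite indicE; case: (_ \in _); rewrite !(lexx, ler01).
Qed.

Lemma energy_indic f t (B : set E) : measurable B -> square_integrable f ->
  (\int[leb]_(x in B) (heat_semigroup t f x ^+ 2)%:E =
   (energy f (\1_B) t)%:E)%E.
Proof.
move=> mB f2; rewrite -energyE//; last exact: weight_indic.
rewrite integral_mkcond; apply: eq_integral => x _; rewrite patchE indicE.
by case: (x \in B); rewrite ?mul1r ?mul0r.
Qed.

Variables (f : E -> R) (r' r : R).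
Hypotheses (f2 : square_integrable f) (r'0 : 0 < r') (r'r : r' < r).

Let b := (r' + r) / 2.
Let psi : E -> R := cutoff r' b.
Let B : set E := eball n r.
Let a := 16 * n%:R * (b - r') ^- 2.
Let D := 384 * n%:R ^+ 2 * (r - b) ^- 4.

Let r'b : r' < b. Proof. exact: (midf_lt r'r).1. Qed.
Let br : b < r. Proof. exact: (midf_lt r'r).2. Qed.
Let a_ge0 : 0 <= a.
Proof. by rewrite /a mulr_ge0 ?mulr_ge0// invr_ge0 exprn_ge0// subr_ge0 ltW. Qed.
Let D_ge0 : 0 <= D.
Proof.
by rewrite /D mulr_ge0 ?mulr_ge0 ?exprn_ge0// invr_ge0 exprn_ge0// subr_ge0 ltW.
Qed.

Let weight_psi : weight psi.
Proof.
split; first exact: measurable_cutoff.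
by move=> x; rewrite cutoff_ge0// cutoff_le1.
Qed.

Let weight_B : weight (\1_B : E -> R).
Proof. by apply: weight_indic; exact: measurable_eball. Qed.

(** The excess [e^{h Delta} psi - psi] is charged to the energy in the large ball,
    except for its tail, which is charged to the total energy. *)
Lemma energy_step t h : 0 <= t -> 0 < h ->
  energy f psi (t + h) <= energy f psi t + a * h * energy f (\1_B) t +
    D * total_energy f * h ^+ 2.
Proof.
move=> t0 h0; rewrite -lee_fin -energyE//.
set w := heat_semigroup t f.
have w2 : square_integrable w by exact: square_integrable_heat_semigroup.
have mw2 : measurable_fun setT (fun x => w x ^+ 2).
  by apply: measurable_funX; case: w2.
have mpsi : measurable_fun setT psi by case: weight_psi.
have mB : measurable_fun setT (\1_B : E -> R) by case: weight_B.
rewrite (_ : (\int[_]_x _)%E =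
    (\int[leb]_x (psi x * heat_semigroup h w x ^+ 2)%:E)%E); last first.
  by apply: eq_integral => x _; rewrite heat_semigroupD.
pose theta y := psi y + a * h * \1_B y + D * h ^+ 2.
apply: le_trans (integral_heat_semigroup_sqr_le h w psi theta h0 w2 mpsi _ _ _) _.
- by move=> x; exact: cutoff_ge0.
- by apply: measurable_funD => //; apply: measurable_funD => //; exact: measurable_funM.
- by move=> y; exact: integral_kernel_cutoff_ball.
rewrite (_ : (\int[_]_y _)%E = (\int[leb]_y ((psi y * w y ^+ 2)%:E +
    ((a * h)%:E * (\1_B y * w y ^+ 2)%:E + (D * h ^+ 2)%:E * (w y ^+ 2)%:E)))%E); last first.
  by apply: eq_integral => y _; rewrite -!EFinM -!EFinD; congr EFin; rewrite /theta; ring.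
have ah0 : 0 <= a * h by rewrite mulr_ge0// ltW.
have Dh0 : 0 <= D * h ^+ 2 by rewrite mulr_ge0 ?sqr_ge0.
have Bw0 y : 0 <= \1_B y * w y ^+ 2 by rewrite mulr_ge0 ?sqr_ge0// indicE.
have mBw : measurable_fun setT (fun y => (\1_B y * w y ^+ 2)%:E).
  by apply/measurable_EFinP; exact: measurable_funM.
have mw2E : measurable_fun setT (fun y => (w y ^+ 2)%:E) by exact/measurable_EFinP.
rewrite ge0_integralD//; last 4 first.
- by move=> y _; rewrite lee_fin mulr_ge0 ?sqr_ge0// cutoff_ge0.
- by apply/measurable_EFinP; exact: measurable_funM.
- move=> y _; rewrite -!EFinM -EFinD lee_fin addr_ge0//.
    by rewrite mulr_ge0.
  by rewrite mulr_ge0// sqr_ge0.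
- by apply: emeasurable_funD; exact: emeasurable_funM.
rewrite ge0_integralD//; last 4 first.
- by move=> y _; rewrite -EFinM lee_fin mulr_ge0.
- exact: emeasurable_funM.
- by move=> y _; rewrite -EFinM lee_fin mulr_ge0// sqr_ge0.
- exact: emeasurable_funM.
rewrite ge0_integralZl_EFin//; last by move=> y _; rewrite lee_fin.
rewrite ge0_integralZl_EFin//; last by move=> y _; rewrite lee_fin sqr_ge0.
rewrite !energyE// -addrA EFinD leeD2l// EFinD -EFinM leeD2l//.
rewrite [X in (_ <= X%:E)%E]mulrAC [leRHS]EFinM; apply: lee_wpmul2l; first by rewrite lee_fin.
exact: integral_sqr_le_total_energy.
Qed.

Lemma integral_ball_le_time_average T : 0 < T ->
  (\int[leb]_(x in eball n r') (heat_semigroup T f x ^+ 2)%:E <=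
   (T^-1 + 64 * n%:R / (r - r') ^+ 2)%:E *
     \int[mu]_(t in `[0%R, T])
       \int[leb]_(x in eball n r) (heat_semigroup t f x ^+ 2)%:E)%E.
Proof.
move=> T0; have mball' := measurable_eball (R := R) (n := n) r'.
rewrite energy_indic//.
rewrite (_ : 64 * n%:R / (r - r') ^+ 2 = a); last first.
  rewrite /a (_ : b - r' = (r - r') / 2); last by rewrite /b; field.
  by field; rewrite subr_eq0 gt_eqF.
under [X in (_ <= _ * X)%E]eq_integral => t _.
  rewrite energy_indic//; last exact: measurable_eball.
  over.
apply: (@le_trans _ _ (energy f psi T)%:E).
  rewrite lee_fin; apply: energy_le => //; first exact: weight_indic.
  move=> x; rewrite indicE; case: (boolP (x \in _)) => [|_]; last exact: cutoff_ge0.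
  by rewrite inE /eball/= => xr'; rewrite /psi cutoff_eq1.
apply: (time_average _ _ (total_energy f) _ (D * total_energy f)) => //.
- exact: measurable_energy.
- exact: measurable_energy.
- by move=> t; exact: energy_ge0.
- move=> t; apply: energy_le => // x; rewrite indicE.
  case: (boolP (x \in _)) => [_|]; first exact: cutoff_le1.
  rewrite notin_setE /B /eball/= => /negP; rewrite -leNgt => rx.
  by rewrite /psi cutoff_eq0// (le_trans (ltW br)).
- by move=> t; exact: energy_le_total.
- by rewrite mulr_ge0// total_energy_ge0.
- exact: energy_step.
Qed.

End UpperBound.

(** * Heat from far away *)

Section Box.
Context {R : realType} {n : nat}.
Local Notation leb := (leb R n).
Variables (l u : 'I_n -> R).
Hypothesis lu : forall i, l i < u i.

Definition box : set (euclid R n) :=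
  [set x | forall i, `[l i, u i]%classic (tnth x i : R)].

Lemma measurable_box : measurable box.
Proof.
rewrite (_ : box = \bigcap_(i in [set: 'I_n]) ((@tnth _ _)^~ i @^-1` `[l i, u i])).
  apply: fin_bigcap_measurable => // i _.
  by rewrite -[X in measurable X]setTI; exact: measurable_tnth.
by apply/seteqP; split => x H i; [move=> _|]; exact: H.
Qed.

Definition box_volume : R := \prod_(i < n) (u i - l i).

Lemma box_volume_gt0 : 0 < box_volume.
Proof. by apply: prodr_gt0 => i _; rewrite subr_gt0. Qed.

Lemma leb_boxE : leb box = box_volume%:E.
Proof.
rewrite (@leb_box R n (fun i => `[l i, u i]%classic)) // /box_volume (big_morph EFin EFinM (erefl _)).
apply: eq_bigr => i _; rewrite lebesgue_measure_itv/= lte_fin lu.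
by rewrite -EFinB.
Qed.

End Box.

Section FarSource.
Context {R : realType} {n : nat}.
Local Notation E := (euclid R n).
Local Notation leb := (leb R n).
Local Notation mu := (@lebesgue_measure R).
Local Notation K t x y := (heat_kernel t (euclid_sub x y)).
Implicit Types (t T L : R) (x p : E).

(** Starting from the kernel at time 1 rather than from a point mass gives a
    square-integrable datum and, by the semigroup law, the kernel at time [1 + t]. *)
Definition gaussian_solution (p : E) (t : R) : E -> R :=
  heat_semigroup t (fun x => K 1 x p).

Lemma gaussian_solutionE p t x : 0 <= t -> gaussian_solution p t x = K (1 + t) x p.
Proof.
rewrite le_eqVlt => /predU1P[<-|t0].
  by rewrite /gaussian_solution /heat_semigroup ltxx addr0.
rewrite /gaussian_solution /heat_semigroup t0 /Rintegral.
by rewrite heat_kernel_chapman_kolmogorov.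
Qed.

Lemma heat_solution_gaussian p : heat_solution (gaussian_solution p).
Proof.
have u0E : gaussian_solution p 0 = fun x => K 1 x p.
  by rewrite /gaussian_solution /heat_semigroup ltxx.
split; last by move=> t _ x; rewrite u0E.
have mK : measurable_fun setT (fun x : E => K 1 x p).
  exact: (measurable_heat_kernel 1 id (cst p)).
rewrite u0E inE; apply/andP; split; rewrite inE//=.
rewrite /finite_norm unlock; apply: poweR_lty.
rewrite (_ : (\int[_]_x _)%E = (\int[leb]_x (K 1 x p ^+ 2)%:E)%E); last first.
  apply: eq_integral => x _.
  by rewrite /= powR_mulrn// ger0_norm ?heat_kernel_ge0.
apply: (@le_lt_trans _ _ (\int[leb]_x ((kernel_peak n 1)%:E * (K 1 x p)%:E))%E).
  apply: ge0_le_integral => //.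
  - by move=> x _; rewrite lee_fin sqr_ge0.
  - by apply/measurable_EFinP; exact: measurable_funX.
  - by apply: emeasurable_funM => //; exact/measurable_EFinP.
  - move=> x _; rewrite -EFinM lee_fin.
    by rewrite expr2 ler_wpM2r ?heat_kernel_ge0// heat_kernel_le_peak.
rewrite ge0_integralZl_EFin ?kernel_peak_ge0//.
- by rewrite integral_heat_kernel// mule1 ltry.
- by move=> x _; rewrite lee_fin heat_kernel_ge0.
- exact/measurable_EFinP.
Qed.

Lemma heat_kernel_sqrE t x : 0 < t ->
  heat_kernel t x ^+ 2 = kernel_peak n t ^+ 2 * expR (- (sqnorm x / (2 * t))).
Proof.
move=> t0; rewrite /heat_kernel exprMn -expRM_natl; congr (_ * expR _).
by field; rewrite gt_eqF.
Qed.

Lemma kernel_peak_le1 t : 1 <= t -> kernel_peak n t <= 1.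
Proof.
move=> t1; have pt : 1 <= 4 * pi * t :> R.
  have := @pi_ge2 R => pi2.
  by rewrite (le_trans t1)// ler_peMl ?(le_trans ler01)//; lra.
rewrite -[leRHS](powRr0 (4 * pi * t)) ler_powR// oppr_le0.
Qed.

Hypothesis n0 : (0 < n)%N.
Let i0 : 'I_n := Ordinal n0.

Definition axis_point (L : R) : E := [tuple (if i == i0 then L else 0 : R) | i < n].

Lemma sqnorm_axisE L x : sqnorm (euclid_sub x (axis_point L)) =
  (L - tnth x i0) ^+ 2 + \sum_(i < n | i != i0) (tnth x i : R) ^+ 2.
Proof.
rewrite sqnorm_sub (bigD1 i0)//= tnth_mktuple eqxx -sqrrN opprB; congr (_ + _).
by apply: eq_bigr => i /negbTE ii0; rewrite tnth_mktuple ii0 subr0.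
Qed.

Lemma coord_sqr_le x (i : 'I_n) : (tnth x i : R) ^+ 2 <= sqnorm x.
Proof.
by rewrite /sqnorm (bigD1 i)//= lerDl sumr_ge0// => j _; exact: sqr_ge0.
Qed.

Lemma coord_le_enorm x (i : 'I_n) : `|tnth x i : R| <= enorm x.
Proof. by rewrite -sqrtr_sqr ler_wsqrtr// coord_sqr_le. Qed.

Lemma gaussian_solution_le T r L t x : 0 <= t <= T -> r <= L -> enorm x < r ->
  gaussian_solution (axis_point L) t x ^+ 2 <=
    expR (- ((L - r) ^+ 2 / (2 * (1 + T)))).
Proof.
move=> /andP[t0 tT] rL xr; rewrite gaussian_solutionE// heat_kernel_sqrE; last by lra.
rewrite -[leRHS]mul1r ler_pM ?sqr_ge0 ?expR_ge0//.
  by rewrite expr_le1 ?kernel_peak_ge0// kernel_peak_le1// lerDl.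
rewrite ler_expR lerN2 ler_pM ?sqr_ge0 ?invr_ge0//.
- by lra.
- rewrite sqnorm_axisE -[leLHS]addr0 lerD//; last first.
    by apply: sumr_ge0 => i _; exact: sqr_ge0.
  rewrite ler_sqr ?nnegrE ?subr_ge0//.
    by rewrite lerD2l lerN2 (le_trans (ler_norm _))// (le_trans (coord_le_enorm _ _))// ltW.
  by rewrite (le_trans (ler_norm _))// (le_trans (coord_le_enorm _ _))// (le_trans (ltW xr)).
- by rewrite lef_pV2 ?posrE; lra.
Qed.

Lemma measurable_gaussian_sqr p t :
  measurable_fun setT (fun x => (gaussian_solution p t x ^+ 2)%:E).
Proof.
apply/measurable_EFinP; apply: measurable_funX; apply: measurable_heat_semigroup.
exact: (measurable_heat_kernel 1 id (cst p)).
Qed.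

Lemma integral_gaussian_ball_le T r L : 0 < T -> 0 < r -> r <= L ->
  (\int[mu]_(t in `[0%R, T])
     \int[leb]_(x in eball n r) (gaussian_solution (axis_point L) t x ^+ 2)%:E <=
   (T * box_volume (fun _ : 'I_n => - r) (fun=> r) *
     expR (- ((L - r) ^+ 2 / (2 * (1 + T)))))%:E)%E.
Proof.
move=> T0 r0 rL; set e := expR _; set vol := box_volume _ _.
have mball := measurable_eball (R := R) (n := n) r.
have lr (i : 'I_n) : - r < r by lra.
have ball_vol : (leb (eball n r) <= vol%:E)%E.
  rewrite -leb_boxE//; apply: le_measure; rewrite ?inE//; first exact: measurable_box.
  move=> x xr i /=; rewrite in_itv/= -ler_norml.
  by rewrite (le_trans (coord_le_enorm _ _))// ltW.
have vol0 : 0 <= vol by rewrite ltW// box_volume_gt0.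
have inner t : 0 <= t <= T ->
    (\int[leb]_(x in eball n r) (gaussian_solution (axis_point L) t x ^+ 2)%:E <=
      (vol * e)%:E)%E.
  move=> tT; apply: (@le_trans _ _ (\int[leb]_(x in eball n r) e%:E)%E).
    apply: ge0_le_integral => //.
    - by move=> x _; rewrite lee_fin sqr_ge0.
    - by apply: measurable_funTS; exact: measurable_gaussian_sqr.
    - by move=> x xr; rewrite lee_fin gaussian_solution_le.
  by rewrite integral_cst// muleC EFinM lee_wpmul2r// lee_fin expR_ge0.
have := heat_solution_gaussian (axis_point L).
move/square_integrable_heat_solution => f2.
have uE t : gaussian_solution (axis_point L) t =
    heat_semigroup t (gaussian_solution (axis_point L) 0).
  by rewrite {2}/gaussian_solution /heat_semigroup ltxx.
apply: (@le_trans _ _ (\int[mu]_(t in `[0%R, T]) (vol * e)%:E)%E).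
  apply: ge0_le_integral => //.
  - by move=> t _; apply: integral_ge0 => x _; rewrite lee_fin sqr_ge0.
  - apply: measurable_funTS.
    under eq_fun => t do rewrite uE energy_indic//.
    by apply/measurable_EFinP; apply: measurable_energy => //; exact: weight_indic.
rewrite integral_cst//= lebesgue_measure_itv/= lte_fin T0 sube0 -EFinM lee_fin.
by rewrite mulrC mulrA.
Qed.

(** A thin box around the axis, between the abscissas [r + d] and [r + 2 * d] with
    [d = (r' - r) / 3], fits into the ball of radius [r'], and the squared distance from
    its points to the source is at most [(L - (r + d)) ^ 2 + d ^ 2]. *)
Lemma integral_gaussian_ball_ge T r r' : 0 < T -> 0 < r -> r < r' ->
  exists2 c : R, 0 < c & forall L, r' <= L ->
  ((c * expR (- ((L - (r + (r' - r) / 3)) ^+ 2 / (2 * (1 + T)))))%:E <=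
    \int[leb]_(x in eball n r') (gaussian_solution (axis_point L) T x ^+ 2)%:E)%E.
Proof.
move=> T0 r0 rr'; pose d := (r' - r) / 3.
have d0 : 0 < d by rewrite /d; lra.
have nR : 1 <= n%:R :> R by rewrite ler1n.
(* The half-width [eps] is such that [n * eps ^ 2 <= d ^ 2]. *)
pose eps := d / n%:R.
have eps0 : 0 < eps by rewrite divr_gt0// (lt_le_trans ltr01).
have neps : n%:R * eps ^+ 2 <= d ^+ 2.
  rewrite /eps exprMn mulrCA ler_piMr ?sqr_ge0//.
  rewrite exprVn ler_pdivrMr ?exprn_gt0 ?(lt_le_trans ltr01)// mul1r.
  by rewrite expr2 ler_peMr// (le_trans ler01).
pose l (i : 'I_n) := if i == i0 then r + d else - eps.
pose u (i : 'I_n) := if i == i0 then r + 2 * d else eps.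
have lu i : l i < u i by rewrite /l /u; case: eqP => _; lra.
have box0 x : box l u x -> r + d <= (tnth x i0 : R) <= r + 2 * d.
  by move/(_ i0); rewrite /l /u eqxx/= in_itv.
have box_rest x : box l u x -> \sum_(i < n | i != i0) (tnth x i : R) ^+ 2 <= d ^+ 2.
  move=> bx; apply: le_trans neps.
  apply: (@le_trans _ _ (\sum_(i < n | i != i0) eps ^+ 2)).
    apply: ler_sum => i /negbTE ii0; have := bx i; rewrite /l /u ii0/= in_itv/=.
    rewrite -ler_norml => xe; rewrite -real_normK ?num_real// ler_sqr ?nnegrE//.
    exact: ltW.
  rewrite [leRHS](_ : _ = \sum_(i < n) eps ^+ 2); last first.
    by rewrite sumr_const card_ord mulr_natl.
  by rewrite [leRHS](bigD1 i0)//= lerDr sqr_ge0.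
have box_ball : box l u `<=` eball n r'.
  have r'0 : 0 < r' by lra.
  move=> x bx; rewrite /eball/= -[ltRHS](gtr0_norm r'0).
  rewrite -sqrtr_sqr ltr_sqrt ?exprn_gt0//.
  have /andP[x1 x2] := box0 x bx.
  rewrite /sqnorm (bigD1 i0)//=.
  have xsq : (tnth x i0 : R) ^+ 2 <= (r + 2 * d) ^+ 2 by rewrite ler_sqr ?nnegrE; lra.
  apply: le_lt_trans (lerD xsq (box_rest x bx)) _.
  have -> : r' = r + 3 * d by rewrite /d; field.
  have : 0 < r * d by rewrite mulr_gt0.
  have : 0 < d ^+ 2 by rewrite exprn_gt0.
  by lra.
pose tau := 1 + T.
have tau0 : 0 < tau by rewrite /tau; lra.
pose c := box_volume l u * (kernel_peak n tau ^+ 2 * expR (- (d ^+ 2 / (2 * tau)))).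
exists c.
  rewrite mulr_gt0 ?box_volume_gt0// mulr_gt0 ?expR_gt0// exprn_gt0// powR_gt0//.
  by rewrite !mulr_gt0 ?pi_gt0.
move=> L r'L; rewrite -/d -/tau.
set e := expR _.
have mB := measurable_eball (R := R) (n := n) r'.
have mBox := measurable_box l u.
apply: (@le_trans _ _ (\int[leb]_(x in box l u)
    (gaussian_solution (axis_point L) T x ^+ 2)%:E)%E); last first.
  apply: ge0_subset_integral => //.
  - by apply: measurable_funTS; exact: measurable_gaussian_sqr.
  - by move=> x _; rewrite lee_fin sqr_ge0.
rewrite (_ : (c * e)%:E = (\int[leb]_(x in box l u)
    (kernel_peak n tau ^+ 2 * expR (- (d ^+ 2 / (2 * tau))) * e)%:E)%E); last first.
  rewrite integral_cst// [X in _ = (_ * X)%E](leb_boxE _ _ lu) -EFinM.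
  by congr EFin; rewrite /c; ring.
apply: ge0_le_integral => //.
- by move=> x _; rewrite lee_fin !mulr_ge0 ?expR_ge0 ?kernel_peak_ge0.
- by apply: measurable_funTS; exact: measurable_gaussian_sqr.
move=> x bx; rewrite lee_fin gaussian_solutionE ?(ltW T0)// heat_kernel_sqrE//.
rewrite -mulrA ler_wpM2l ?sqr_ge0// -expRD ler_expR -opprD lerN2 -mulrDl.
rewrite ler_wpM2r ?invr_ge0 ?mulr_ge0 ?(ltW tau0)//.
rewrite sqnorm_axisE addrC lerD ?box_rest//.
have /andP[x1 x2] := box0 x bx.
have r'E : r' = r + 3 * d by rewrite /d; field.
by rewrite ler_sqr ?nnegrE; lra.
Qed.

Lemma no_outer_bound T r r' : 0 < T -> 0 < r -> r < r' ->
  ~ (exists C : R, forall u : R -> E -> R, heat_solution u ->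
    (\int[leb]_(x in eball n r') ((u T x) ^+ 2)%:E <=
     C%:E * \int[mu]_(t in `[0%R, T])
       \int[leb]_(x in eball n r) ((u t x) ^+ 2)%:E)%E).
Proof.
move=> T0 r0 rr' [C HC].
have [c c0 lower] := integral_gaussian_ball_ge T r r' T0 r0 rr'.
pose d := (r' - r) / 3; have d0 : 0 < d by rewrite /d; lra.
pose tau := 1 + T; have tau0 : 0 < tau by rewrite /tau; lra.
pose c' := `|C| * (T * box_volume (fun _ : 'I_n => - r) (fun=> r)).
have c'0 : 0 <= c'.
  rewrite mulr_ge0// mulr_ge0 ?(ltW T0)// ltW// box_volume_gt0// => i.
  lra.
(* The exponents differ by [d * (2 * L - 2 * r - d) / (2 * tau)]; this choice of [L]
   makes that at least [c' / c]. *)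
pose L := r' + tau * c' / (d * c).
have r'L : r' <= L.
  by rewrite lerDl; apply: divr_ge0; apply: mulr_ge0 => //; exact: ltW.
have rL : r <= L by lra.
set p := axis_point L.
have bound : c * expR (- ((L - (r + d)) ^+ 2 / (2 * tau))) <=
    c' * expR (- ((L - r) ^+ 2 / (2 * tau))).
  rewrite -lee_fin; apply: le_trans (lower L r'L) _.
  apply: le_trans (HC _ (heat_solution_gaussian p)) _.
  apply: (@le_trans _ _ (`|C|%:E * \int[mu]_(t in `[0%R, T])
      \int[leb]_(x in eball n r) (gaussian_solution p t x ^+ 2)%:E)%E).
    apply: lee_wpmul2r; last by rewrite lee_fin ler_norm.
    apply: integral_ge0 => t _; apply: integral_ge0 => x _.
    by rewrite lee_fin sqr_ge0.
  rewrite /c' -[X in (_ <= X%:E)%E]mulrA [leRHS]EFinM; apply: lee_wpmul2l => //.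
  exact: integral_gaussian_ball_le.
pose X := (L - r) ^+ 2 / (2 * tau) - (L - (r + d)) ^+ 2 / (2 * tau).
have cX : c * expR X <= c'.
  rewrite -(ler_pM2r (expR_gt0 (- ((L - r) ^+ 2 / (2 * tau))))) -mulrA -expRD.
  by rewrite (_ : X + _ = - ((L - (r + d)) ^+ 2 / (2 * tau)))// /X; ring.
have Xge : c' / c <= X.
  have -> : c' / c = d * (2 * (tau * c' / (d * c))) / (2 * tau).
    by field; rewrite ?gt_eqF.
  rewrite /X -mulrBl ler_wpM2r ?invr_ge0 ?mulr_ge0 ?(ltW tau0)//.
  have -> : (L - r) ^+ 2 - (L - (r + d)) ^+ 2 = d * (2 * L - 2 * r - d) by ring.
  by rewrite ler_wpM2l ?(ltW d0)// /L /d; lra.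
have : c * (1 + c' / c) <= c'.
  apply: le_trans cX; rewrite ler_wpM2l ?(ltW c0)//.
  by apply: le_trans (expR_ge1Dx X); rewrite lerD2l.
by rewrite mulrDr mulr1 mulrCA divff ?gt_eqF// mulr1; lra.
Qed.

End FarSource.

Theorem theorem3p2 (R : realType) :
  (exists C : R, 0 < C /\
     forall (n : nat) (T r' r : R),
       (0 < n)%N -> 0 < T -> 0 < r' -> r' < r ->
       forall u : R -> euclid R n -> R, heat_solution u ->
         (\int[leb R n]_(x in eball n r') ((u T x) ^+ 2)%:E <=
          (T^-1 + C * n%:R / (r - r') ^+ 2)%:E *
          \int[lebesgue_measure]_(t in `[0%R, T])
            \int[leb R n]_(x in eball n r) ((u t x) ^+ 2)%:E)%E)
  /\
  (forall (n : nat) (T r' r : R),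
     (0 < n)%N -> 0 < T -> 0 < r -> r < r' ->
     ~ (exists C : R,
          forall u : R -> euclid R n -> R, heat_solution u ->
            (\int[leb R n]_(x in eball n r') ((u T x) ^+ 2)%:E <=
             C%:E *
             \int[lebesgue_measure]_(t in `[0%R, T])
               \int[leb R n]_(x in eball n r) ((u t x) ^+ 2)%:E)%E)).
Proof.
split; last by move=> n T r' r n0 T0 r0 rr'; exact: no_outer_bound.
exists 64; split=> // n T r' r _ T0 r'0 r'r u u_sol.
have f2 := square_integrable_heat_solution u u_sol.
have [_ uE] := u_sol.
have := integral_ball_le_time_average (u 0) r' r f2 r'0 r'r T T0.
under eq_integral => x _ do rewrite -uE ?(ltW T0)//.
rewrite [X in (_ <= _ * X)%E -> _](_ : _ = (\int[lebesgue_measure]_(t in `[0%R, T])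
  \int[leb R n]_(x in eball n r) ((u t x) ^+ 2)%:E)%E)//.
apply: eq_integral => t; rewrite inE/= in_itv/= => /andP[t0 _].
by apply: eq_integral => x _; rewrite uE.
Qed.
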